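(* Let $M$ be a compact topological space, $\phi: M\to M$ a homeomorphism (an invertible discrete-time dynamical system), $\omega: M\to\mathbb{R}^d$ a continuous observation map, and $F:\mathbb{R}^N\times\mathbb{R}^d\to\mathbb{R}^N$ a continuous state map that is locally contracting in the state variable. Let $V\subset\mathbb{R}^N$ be a closed set such that $F(V\times\omega(M))\subset V$ and where $F$ is state-contracting, that is, there is a constant $0<c<1$ with $\|F(\mathbf{x}_1,\mathbf{z})-F(\mathbf{x}_2,\mathbf{z})\|\le c\|\mathbf{x}_1-\mathbf{x}_2\|$ for all $\mathbf{x}_1,\mathbf{x}_2\in V$, $\mathbf{z}\in\omega(M)$. Then: (i) The corresponding restricted system $F:V\times\omega(M)\to V$ has the $(\phi,\omega)$-echo state property, and hence the generalized synchronization $f_{(\phi,\omega,F)}$ is well defined. In this case, the generalized synchronization $f_{(\phi,\omega,F)}:M\to V$ is continuous and it is the only map with that codomain that satisfies the identity $$f_{(\phi,\omega,F)}(m)=F\left(f_{(\phi,\omega,F)}(\phi^{-1}(m)),\omega(m)\right)\quad\text{for all } m\in M.$$ (ii) The same conclusion holds when $M$ is a compact differentiable manifold, $\phi$ is a $C^1$ diffeomorphism of $M$, $\omega$ is of class $C^1$, $F$ is of class $C^2$, and $V$ is closed and convex. In this case, if $$L_{F_x}<\min\left\{1,\,1/\|T\phi^{-1}\|_\infty\right\},$$ then the associated generalized synchronization $f_{(\phi,\omega,F)}$ is continuously differentiable.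
   Context: Norms on Euclidean spaces are Euclidean norms. A state map $F:\mathbb{R}^N\times\mathbb{R}^d\to\mathbb{R}^N$ is locally contracting in the state variable (with respect to $\omega$) if there exist a constant $0<c<1$ and a closed convex set $V_0\subset\mathbb{R}^N$ such that $F(V_0\times\omega(M))\subset V_0$ and $\|F(\mathbf{x}_1,\mathbf{z})-F(\mathbf{x}_2,\mathbf{z})\|\le c\|\mathbf{x}_1-\mathbf{x}_2\|$ for all $\mathbf{x}_1,\mathbf{x}_2\in V_0$, $\mathbf{z}\in\omega(M)$. The restricted system $F:V\times\omega(M)\to V$ has the $(\phi,\omega)$-echo state property (ESP) if for every $m\in M$ there exists a unique sequence $\mathbf{x}=(\mathbf{x}_t)_{t\in\mathbb{Z}}\in V^{\mathbb{Z}}$ with $\mathbf{x}_t=F(\mathbf{x}_{t-1},\omega(\phi^t(m)))$ for all $t\in\mathbb{Z}$. In that case, $f_{(\phi,\omega,F)}:M\to V$ is defined by $f_{(\phi,\omega,F)}(m):=\mathbf{x}_0$, where $\mathbf{x}$ is the unique such sequence associated to $m$; it is a generalized synchronization in the sense that this sequence satisfies $\mathbf{x}_t=f_{(\phi,\omega,F)}(\phi^t(m))$ for all $t\in\mathbb{Z}$. In (ii), the manifold $M$ is finite-dimensional, connected, Hausdorff and second-countable, and is endowed with a Riemannian metric $g$. Define $$L_{F_x}:=\sup_{(\mathbf{x},\mathbf{z})\in V\times\omega(M)}\|D_xF(\mathbf{x},\mathbf{z})\|,$$ where $D_xF$ is the partial derivative of $F$ with respect to the state variable, with the operator norm. For a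 $C^1$ map $\psi:M\to M$, with tangent map $T_m\psi:T_mM\to T_{\psi(m)}M$ at $m$, set $$\|T\psi\|_\infty:=\sup_{m\in M}\|T_m\psi\|,\qquad \|T_m\psi\|:=\sup_{0\ne v\in T_mM}\frac{\left(g(\psi(m))(T_m\psi\cdot v,T_m\psi\cdot v)\right)^{1/2}}{\left(g(m)(v,v)\right)^{1/2}}.$$
   Formalization: V is assumed nonempty, and for unbounded V uniqueness (in the echo state property and of the map f) is claimed only among bounded sequences and bounded maps; the literal claim fails for F(x,z)=x/2, V=ℝ. For bounded V it is as stated. *)

(* Defs.v *)
From HB Require Import structures.
From mathcomp Require Import all_boot all_order all_algebra.
From mathcomp Require Import all_classical all_reals all_analysis.

Set Implicit Arguments.
Unset Strict Implicit.
Unset Printing Implicit Defensive.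
Import Order.TTheory GRing.Theory Num.Theory.
Import numFieldNormedType.Exports.
Local Open Scope classical_set_scope.
Local Open Scope ring_scope.

(* The library norm on ['rV[R]_n] is the sup norm; it induces the usual
   topology, differentiability and boundedness, but metric quantities have to
   be measured with the Euclidean norm. *)
Definition enorm (R : realType) (n : nat) (v : 'rV[R]_n) : R :=
  Num.sqrt (\sum_(i < n) v 0 i ^+ 2).

(* Supremum in [0, +oo], so that the supremum of the empty set is 0. *)
Definition sup_ge0 (R : realType) (A : set (\bar R)) : \bar R :=
  maxe 0%E (ereal_sup A).

Definition opnorm (R : realType) (n k : nat) (f : 'rV[R]_n -> 'rV[R]_k)
    : \bar R :=
  sup_ge0 [set (enorm (f v) / enorm v)%:E | v in [set v | v != 0]].

(* [f] is of class C^k on the open set [D].  The spaces being finite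
   dimensional, ['d f] is of class C^k iff ['d f x v] is so in [x] for every
   fixed [v]. *)
Fixpoint Ck (R : realType) (U W : normedModType R) (k : nat) (D : set U)
    (f : U -> W) : Prop :=
  if k is k'.+1 then
    (forall x, D x -> differentiable f x) /\
    (forall v, Ck k' D (fun x => 'd f x v))
  else forall x, D x -> {for x, continuous f}.

(** * State space systems *)

Definition state_invariant (R : realType) (N d : nat)
    (F : 'rV[R]_N * 'rV[R]_d -> 'rV[R]_N) (V : set 'rV[R]_N)
    (Z : set 'rV[R]_d) : Prop :=
  forall x z, V x -> Z z -> V (F (x, z)).

Definition state_contracting (R : realType) (N d : nat)
    (F : 'rV[R]_N * 'rV[R]_d -> 'rV[R]_N) (V : set 'rV[R]_N)
    (Z : set 'rV[R]_d) : Prop :=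
  exists2 c : R, 0 < c < 1 &
    forall x1 x2 z, V x1 -> V x2 -> Z z ->
      enorm (F (x1, z) - F (x2, z)) <= c * enorm (x1 - x2).

Definition locally_contracting (R : realType) (M : Type) (N d : nat)
    (omega : M -> 'rV[R]_d) (F : 'rV[R]_N * 'rV[R]_d -> 'rV[R]_N) : Prop :=
  exists V0 : set 'rV[R]_N,
    [/\ closed V0, convex_set V0, state_invariant F V0 (range omega)
      & state_contracting F V0 (range omega)].

(* [phi^t] for [t] in Z, where [phiV] is the inverse of [phi]. *)
Definition ziter (M : Type) (phi phiV : M -> M) (t : int) : M -> M :=
  match t with
  | Posz k => iter k phi
  | Negz k => iter k.+1 phiV
  end.

Definition state_solution (R : realType) (M : Type) (N d : nat)
    (phi phiV : M -> M) (omega : M -> 'rV[R]_d)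
    (F : 'rV[R]_N * 'rV[R]_d -> 'rV[R]_N) (m : M) (x : int -> 'rV[R]_N)
    : Prop :=
  forall t : int, x t = F (x (t - 1), omega (ziter phi phiV t m)).

(* [maps_into V T] is the set V^T.  On an unbounded V, uniqueness of solutions
   fails in V^Z (for F(x,z) = x/2 on the line, t |-> 2^-t x0 is a solution for
   every x0) and holds among bounded sequences only; hence the notions below
   are parameterized by a class [C] of maps, which is either [maps_into V]
   or [bounded_maps_into V].  The two coincide when V is bounded. *)
Definition maps_into (R : realType) (N : nat) (V : set 'rV[R]_N) (T : Type)
    : set (T -> 'rV[R]_N) :=
  [set f | forall t, V (f t)].

Definition bounded_maps_into (R : realType) (N : nat) (V : set 'rV[R]_N)
    (T : Type) : set (T -> 'rV[R]_N) :=
  maps_into V (T := T) `&` bounded_fun.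

Arguments maps_into {R N} V T.
Arguments bounded_maps_into {R N} V T.

Definition echo_state_property (R : realType) (M : Type) (N d : nat)
    (phi phiV : M -> M) (omega : M -> 'rV[R]_d)
    (F : 'rV[R]_N * 'rV[R]_d -> 'rV[R]_N)
    (C : forall T : Type, set (T -> 'rV[R]_N)) : Prop :=
  forall m : M, exists! x : int -> 'rV[R]_N,
    C int x /\ state_solution phi phiV omega F m x.

(* f(m) = x_0 for the solution x associated to m; only meaningful under the
   echo state property. *)
Definition generalized_synchronization (R : realType) (M : Type) (N d : nat)
    (phi phiV : M -> M) (omega : M -> 'rV[R]_d)
    (F : 'rV[R]_N * 'rV[R]_d -> 'rV[R]_N)
    (C : forall T : Type, set (T -> 'rV[R]_N)) (m : M) : 'rV[R]_N :=
  xget (fun=> 0)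
    [set x : int -> 'rV[R]_N | C int x /\ state_solution phi phiV omega F m x]
    0.

Definition synchronizes (R : realType) (M : topologicalType) (N d : nat)
    (phi phiV : M -> M) (omega : M -> 'rV[R]_d)
    (F : 'rV[R]_N * 'rV[R]_d -> 'rV[R]_N)
    (C : forall T : Type, set (T -> 'rV[R]_N)) : Prop :=
  let f := generalized_synchronization phi phiV omega F C in
  [/\ echo_state_property phi phiV omega F C,
      continuous f,
      C M f,
      (forall m, f m = F (f (phiV m), omega m))
    & forall h : M -> 'rV[R]_N, C M h ->
        (forall m, h m = F (h (phiV m), omega m)) -> h = f].

Definition sup_norm_DxF (R : realType) (N d : nat)
    (F : 'rV[R]_N * 'rV[R]_d -> 'rV[R]_N) (V : set 'rV[R]_N)
    (Z : set 'rV[R]_d) : \bar R :=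
  sup_ge0 [set opnorm ('d (fun x => F (x, xz.2)) (xz.1)) | xz in V `*` Z].

(** * Differentiable manifolds *)

Record chart (R : realType) (M : topologicalType) (n : nat) := Chart {
  cdom : set M;
  cimg : set 'rV[R]_n;
  cmap : M -> 'rV[R]_n;
  cinv : 'rV[R]_n -> M;
  cdom_open : open cdom;
  cimg_open : open cimg;
  cmap_img : forall m, cdom m -> cimg (cmap m);
  cinv_dom : forall u, cimg u -> cdom (cinv u);
  cmapK : forall m, cdom m -> cinv (cmap m) = m;
  cinvK : forall u, cimg u -> cmap (cinv u) = u;
  cmap_continuous : {within cdom, continuous cmap};
  cinv_continuous : {within cimg, continuous cinv}
}.

(* The representative of [psi] in the charts [c] and [c'], and the open set
   where it is meaningful. *)
Definition in_charts (R : realType) (M : topologicalType) (n : nat)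
    (psi : M -> M) (c c' : chart R M n) : 'rV[R]_n -> 'rV[R]_n :=
  cmap c' \o psi \o cinv c.

Definition in_charts_dom (R : realType) (M : topologicalType) (n : nat)
    (psi : M -> M) (c c' : chart R M n) : set 'rV[R]_n :=
  cimg c `&` (psi \o cinv c) @^-1` cdom c'.

Definition C1_map (R : realType) (M : topologicalType) (n : nat)
    (A : set (chart R M n)) (psi : M -> M) : Prop :=
  continuous psi /\
  forall c c', A c -> A c' ->
    Ck 1 (in_charts_dom psi c c') (in_charts psi c c').

Definition C1_function (R : realType) (M : topologicalType) (n k : nat)
    (A : set (chart R M n)) (f : M -> 'rV[R]_k) : Prop :=
  forall c, A c -> Ck 1 (cimg c) (f \o cinv c).

(* The charts cover [M] and the coordinate changes are of class C^1. *)
Definition C1_atlas (R : realType) (M : topologicalType) (n : nat)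
    (A : set (chart R M n)) : Prop :=
  (forall m, exists2 c, A c & cdom c m) /\
  (forall c c', A c -> A c' -> Ck 1 (in_charts_dom id c c') (in_charts id c c')).

(* A tangent vector at [m] is represented by its coordinates [v] in a chart [c]
   around [m]; its coordinates in another chart [c'] are
   [tangent_map id c c' m v]. *)
Definition tangent_map (R : realType) (M : topologicalType) (n : nat)
    (psi : M -> M) (c c' : chart R M n) (m : M) : 'rV[R]_n -> 'rV[R]_n :=
  'd (in_charts psi c c') (cmap c m).

(* A Riemannian metric is given by its Gram matrices in the charts of the atlas;
   [gram_change] is the transformation law that makes them define an inner
   product on each tangent space.  On a C^1 manifold the natural regularity
   of a metric is continuity. *)
Record riemannian_metric (R : realType) (M : topologicalType) (n : nat)
    (A : set (chart R M n)) := RiemannianMetric {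
  gram : chart R M n -> M -> 'M[R]_n;
  gram_sym : forall c m, A c -> cdom c m -> (gram c m)^T = gram c m;
  gram_posdef : forall c m (v : 'rV[R]_n), A c -> cdom c m -> v != 0 ->
    0 < (v *m gram c m *m v^T) 0 0;
  gram_change : forall c c' m (u v : 'rV[R]_n), A c -> A c' -> cdom c m -> cdom c' m ->
    (tangent_map id c c' m u *m gram c' m *m (tangent_map id c c' m v)^T) 0 0 =
    (u *m gram c m *m v^T) 0 0;
  gram_continuous : forall c, A c -> {within cdom c, continuous (gram c)}
}.

Definition tangent_norm (R : realType) (M : topologicalType) (n : nat)
    (A : set (chart R M n)) (g : riemannian_metric A) (c : chart R M n) (m : M)
    (v : 'rV[R]_n) : R :=
  Num.sqrt ((v *m gram g c m *m v^T) 0 0).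

(* By [gram_change] the quotients do not depend on the charts [c] around [m]
   and [c'] around [psi m]. *)
Definition tangent_map_norm (R : realType) (M : topologicalType) (n : nat)
    (A : set (chart R M n)) (g : riemannian_metric A) (psi : M -> M) (m : M)
    : \bar R :=
  sup_ge0 [set r | exists c c' (v : 'rV[R]_n),
    [/\ A c /\ cdom c m, A c' /\ cdom c' (psi m), v != 0 &
      r = (tangent_norm g c' (psi m) (tangent_map psi c c' m v)
           / tangent_norm g c m v)%:E]].

Definition tangent_map_supnorm (R : realType) (M : topologicalType) (n : nat)
    (A : set (chart R M n)) (g : riemannian_metric A) (psi : M -> M) : \bar R :=
  sup_ge0 (range (tangent_map_norm g psi)).

(* Main.v *)
Require Import Defs.
From HB Require Import structures.
From mathcomp Require Import all_boot all_order all_algebra.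
From mathcomp Require Import all_classical all_reals all_analysis.
From mathcomp Require Import ring lra.

Set Implicit Arguments.
Unset Strict Implicit.
Unset Printing Implicit Defensive.
Import Order.TTheory GRing.Theory Num.Theory.
Import numFieldNormedType.Exports.
Local Open Scope classical_set_scope.
Local Open Scope ring_scope.

(** The maps [M -> V] satisfying the identity of the generalized
    synchronization are the fixed points of the operator that sends [h] to
    [m |-> F (h (phiV m), omega m)]. This operator contracts the uniform
    distance by the factor [c], and it preserves a ball around any point [v0]
    of [V], because [omega] has compact range. Its iterates [sync_iter] from the
    constant map [v0] therefore converge uniformly to a continuous bounded fixed
    point [f] ([sync_limit]). Along an orbit, [t |-> f (phi^t m)] is a solution
    in [V], and two bounded solutions coincide because their distance at time
    [t] is at most [c^k] times their distance at time [t - k]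
    ([bounded_solution_unique]). This gives the echo state property, identifies
    the generalized synchronization with [f], and shows that no other bounded
    map satisfies the identity ([synchronizesP]). When [V] is bounded, all maps
    into [V] are bounded.

    In the smooth case every iterate [f_k] is of class C^1, and the chain rule
    ([diff_sync_iterS]) reads
      [T f_(k+1) = D_x F . T f_k . T phiV + D_z F . T omega].
    Measure tangent vectors of [M] with the Riemannian norm and states with the
    Euclidean norm. If [l] and [tau] are the suprema in the hypothesis
    ([contraction_rates]), then [T f_k |-> T f_(k+1)] contracts by the factor
    [l tau < 1], up to the variation of [D F] between the base points of
    successive iterates. These base points stay in a compact set, on which [D F]
    is uniformly continuous, and they converge uniformly. Hence the
    differentials of the iterates are bounded ([diff_sync_iter_bounded]) and
    uniformly Cauchy ([diff_sync_iter_cauchy]). Read in a chart, where the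
    Riemannian norm is locally dominated by the coordinate norm
    ([tangent_norm_upper]), this is the hypothesis of the theorem on the limits
    of C^1 maps with locally uniformly convergent differentials ([C1_limit]),
    which makes [f] a C^1 map. *)

(** * The Euclidean norm *)

Lemma enorm_ge0 (R : realType) n (v : 'rV[R]_n) : 0 <= enorm v.
Proof. exact: sqrtr_ge0. Qed.

Lemma enorm_sqr (R : realType) n (v : 'rV[R]_n) :
  enorm v ^+ 2 = \sum_(i < n) v 0 i ^+ 2.
Proof. by rewrite sqr_sqrtr// sumr_ge0// => i _; exact: sqr_ge0. Qed.

Lemma enorm0 (R : realType) n : enorm (0 : 'rV[R]_n) = 0.
Proof. by rewrite /enorm big1 ?sqrtr0// => i _; rewrite mxE expr0n. Qed.

Lemma enormN (R : realType) n (v : 'rV[R]_n) : enorm (- v) = enorm v.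
Proof.
by congr Num.sqrt; apply: eq_bigr => i _; rewrite mxE sqrrN.
Qed.

Lemma coord_le_norm (R : realType) p n (A : 'M[R]_(p, n)) i j : `|A i j| <= `|A|.
Proof.
by rewrite /Num.norm/= mx_normrE; exact: (le_bigmax _ (fun k => `|A k.1 k.2|) (i, j)).
Qed.

Lemma norm_le_coord (R : realType) n (v : 'rV[R]_n) (r : R) :
  0 <= r -> (forall i, `|v 0 i| <= r) -> `|v| <= r.
Proof.
move=> r0 vr; rewrite /Num.norm/= mx_normrE; apply/bigmax_leP; split => // -[i j] _.
by rewrite ord1; exact: vr.
Qed.

Lemma norm_le_enorm (R : realType) n (v : 'rV[R]_n) : `|v| <= enorm v.
Proof.
apply: norm_le_coord => [|i]; first exact: enorm_ge0.
rewrite -sqrtr_sqr ler_wsqrtr// (bigD1 i)//= lerDl.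
by apply: sumr_ge0 => j _; exact: sqr_ge0.
Qed.

Lemma enorm_le_norm (R : realType) n (v : 'rV[R]_n) :
  enorm v <= Num.sqrt n%:R * `|v|.
Proof.
rewrite -[`|v|]ger0_norm// -sqrtr_sqr -sqrtrM// ler_wsqrtr//.
rewrite -[n in n%:R]card_ord mulr_natl -sumr_const; apply: ler_sum => i _.
by rewrite -real_normK ?num_real// lerXn2r ?nnegrE// coord_le_norm.
Qed.

(** The Cauchy-Schwarz inequality, read off from the nonnegativity of the sum
    of the squares of the coordinates of [|w| v - |v| w]. *)
Lemma enormD (R : realType) n (v w : 'rV[R]_n) :
  enorm (v + w) <= enorm v + enorm w.
Proof.
have CS : \sum_(i < n) v 0 i * w 0 i <= enorm v * enorm w.
  have [v0|v0] := eqVneq (enorm v) 0.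
    rewrite v0 mul0r big1// => i _.
    have : `|v 0 i| <= 0 by rewrite -v0 (le_trans (coord_le_norm v 0 i))// norm_le_enorm.
    by rewrite normr_le0 => /eqP ->; rewrite mul0r.
  have [w0|w0] := eqVneq (enorm w) 0.
    rewrite w0 mulr0 big1// => i _.
    have : `|w 0 i| <= 0 by rewrite -w0 (le_trans (coord_le_norm w 0 i))// norm_le_enorm.
    by rewrite normr_le0 => /eqP ->; rewrite mulr0.
  have vw0 : 0 < enorm v * enorm w.
    by rewrite mulr_gt0// lt0r ?v0 ?w0 enorm_ge0.
  (* The sum of squares equals [2 |v| |w| (|v| |w| - <v, w>)]. *)
  have : 0 <= \sum_(i < n) (enorm w * v 0 i - enorm v * w 0 i) ^+ 2.
    by apply: sumr_ge0 => i _; exact: sqr_ge0.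
  have -> : \sum_(i < n) (enorm w * v 0 i - enorm v * w 0 i) ^+ 2 =
      2 * (enorm v * enorm w) * (enorm v * enorm w - \sum_(i < n) v 0 i * w 0 i).
    transitivity (enorm w ^+ 2 * (\sum_(i < n) v 0 i ^+ 2) -
        2 * (enorm v * enorm w) * (\sum_(i < n) v 0 i * w 0 i) +
        enorm v ^+ 2 * (\sum_(i < n) w 0 i ^+ 2)).
      rewrite !mulr_sumr -sumrB -big_split/=; apply: eq_bigr => i _; ring.
    rewrite -!enorm_sqr; ring.
  by rewrite pmulr_rge0 ?subr_ge0// mulr_gt0.
rewrite -(@ler_pXn2r _ 2) ?nnegrE ?addr_ge0 ?enorm_ge0//.
rewrite enorm_sqr sqrrD !enorm_sqr.
have -> : \sum_(i < n) (v + w) 0 i ^+ 2 =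
   \sum_(i < n) v 0 i ^+ 2 + (\sum_(i < n) v 0 i * w 0 i) *+ 2 + \sum_(i < n) w 0 i ^+ 2.
  rewrite -sumrMnl -!big_split/=; apply: eq_bigr => i _; rewrite mxE; ring.
by rewrite lerD2r lerD2l lerMn2r.
Qed.

Lemma enorm_triangle (R : realType) n (u v w : 'rV[R]_n) :
  enorm (u - w) <= enorm (u - v) + enorm (v - w).
Proof. by rewrite -[u - w](subrKA v) enormD. Qed.

Lemma enormC (R : realType) n (v w : 'rV[R]_n) : enorm (v - w) = enorm (w - v).
Proof. by rewrite -enormN opprB. Qed.

(** * Contractions and uniform limits *)

(** Iterating [s |-> rho s + e] with [e] a small fraction of [s] shrinks any
    initial bound to [0]; this turns asymptotically contracting estimates into
    convergence without explicit rates. *)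
Lemma contraction_all (R : realType) (Q : R -> Prop) (rho s0 : R) :
  0 <= rho < 1 -> (forall s t, s <= t -> Q s -> Q t) -> Q s0 ->
  (forall s e, 0 < s -> 0 < e -> Q s -> Q (rho * s + e)) ->
  forall e, 0 < e -> Q e.
Proof.
move=> /andP[r0 r1] Qle Q0 Qrho e e0.
(* Any [q] strictly between [rho] and [1] works: [e := (q - rho) s] is then
   positive, and [rho s + e = q s]. *)
pose s1 := Num.max s0 1; pose q := (1 + rho) / 2.
have s1_gt0 : 0 < s1 by rewrite lt_max ltr01 orbT.
have q0 : 0 < q by rewrite /q; lra.
have q1 : q < 1 by rewrite /q; lra.
have Qn n : Q (q ^+ n * s1).
  elim: n => [|n IH]; first by rewrite expr0 mul1r; apply: Qle Q0; rewrite le_max lexx.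
  have sn0 : 0 < q ^+ n * s1 by rewrite mulr_gt0// exprn_gt0.
  have := Qrho _ ((q - rho) * (q ^+ n * s1)) sn0 _ IH.
  have -> : rho * (q ^+ n * s1) + (q - rho) * (q ^+ n * s1) = q ^+ n.+1 * s1.
    by rewrite exprS; ring.
  by apply; rewrite mulr_gt0// /q; lra.
have : q ^+ n @[n --> \oo] --> 0 by apply: cvg_expr; rewrite gtr0_norm.
move=> /cvgrPdist_lt /(_ (e / s1)) []; first by rewrite divr_gt0.
move=> n _ /(_ n (leqnn n)); rewrite sub0r normrN gtr0_norm ?exprn_gt0//.
by rewrite ltr_pdivlMr// => /ltW /Qle; apply.
Qed.

(** A weighted form of the completeness of the space of maps into [R^N]. *)
Lemma uniform_limit (R : realType) (X : Type) N (w : X -> R)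
    (D : nat -> X -> 'rV[R]_N) : (forall x, 0 <= w x) ->
  (forall e, 0 < e -> exists n, forall k l, (n <= k)%N -> (n <= l)%N ->
     forall x, `|D l x - D k x| <= e * w x) ->
  exists G : X -> 'rV[R]_N, forall e, 0 < e -> exists n, forall k, (n <= k)%N ->
     forall x, `|G x - D k x| <= e * w x.
Proof.
move=> w0 Dcauchy.
have cvgD x : cvg (D n x @[n --> \oo]).
  apply/cauchy_cvgP/cauchyP => e e0.
  (* The weight may vanish at [x], hence the [+ 1]. *)
  have e1 : 0 < e / (w x + 1) by rewrite divr_gt0// ltr_wpDl.
  have [n Dn] := Dcauchy _ e1; exists (D n x); exists n => // k /= nk.
  rewrite -ball_normE/= distrC; apply: le_lt_trans (Dn _ _ (leqnn n) nk x) _.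
  rewrite mulrAC ltr_pdivrMr ?ltr_wpDl//.
  by rewrite ltr_pM2l// ltrDl.
exists (fun x => lim (D n x @[n --> \oo])) => e e0.
have [n Dn] := Dcauchy e e0; exists n => k nk x.
have cvN : `|D l x - D k x| @[l --> \oo] --> `|lim (D n x @[n --> \oo]) - D k x|.
  by apply: cvg_norm; apply: cvgB; [exact: cvgD|exact: cvg_cst].
by apply: (cvgr_to_le cvN); exists n => // l nl; exact: Dn.
Qed.

(** Being a local condition, this covers both uniform and locally uniform
    limits. *)
Lemma continuous_limit (R : realType) (X : topologicalType) N
    (f : X -> 'rV[R]_N) x :
  (forall e, 0 < e -> exists2 h : X -> 'rV[R]_N, {for x, continuous h} &
     \forall y \near x, `|f y - h y| <= e) ->
  {for x, continuous f}.
Proof.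
move=> fh; apply/cvgrPdist_le => e e0.
have [h hx fhe] := fh (e / 3) (divr_gt0 e0 (ltr0Sn _ _)).
have /cvgrPdist_le /(_ (e / 3) (divr_gt0 e0 (ltr0Sn _ _))) hxe := hx.
have fhx := nbhs_singleton fhe.
near=> y.
have hxy : `|h x - h y| <= e / 3 by near: y.
have fhy : `|f y - h y| <= e / 3 by near: y.
have -> : f x - f y = (f x - h x) + (h x - h y) + (h y - f y).
  by rewrite !subrKA.
rewrite (le_trans (ler_normD _ _))// (le_trans (lerD (ler_normD _ _) (lexx _)))//.
by rewrite [`|h y - _|]distrC; lra.
Unshelve. all: by end_near. Qed.

Lemma bounded_fun_rVP (R : realType) (X : Type) n (f : X -> 'rV[R]_n) :
  bounded_fun f <-> exists K, forall x, `|f x| <= K.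
Proof.
split=> [/pinfty_ex_gt0[K _ fK]|[K fK]]; first by exists K => x; exact: fK.
exists K; split; first exact: num_real.
by move=> r Kr x _; exact: le_trans (fK x) (ltW Kr).
Qed.

Lemma compact_bounded_fun (R : realType) (X : topologicalType) n
    (f : X -> 'rV[R]_n) :
  compact [set: X] -> continuous f -> bounded_fun f.
Proof.
move=> cX cf; have : compact (f @` setT).
  by apply: continuous_compact => //; exact: continuous_subspaceT.
move=> /compact_bounded /pinfty_ex_gt0[K _ fK]; apply/bounded_fun_rVP.
by exists K => x; apply: fK; exists x.
Qed.

(** * Existence and uniqueness of the generalized synchronization *)

Section Synchronization.
Variables (R : realType) (M : topologicalType) (N d : nat).
Variables (phi phiV : M -> M) (omega : M -> 'rV[R]_d).
Variables (F : 'rV[R]_N * 'rV[R]_d -> 'rV[R]_N) (V : set 'rV[R]_N).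
Variables (c : R) (v0 : 'rV[R]_N).

(** The Picard iterates, from a constant map, of the operator whose fixed points
    are the maps satisfying the identity of the generalized synchronization. *)
Fixpoint sync_iter (k : nat) (m : M) : 'rV[R]_N :=
  if k is k'.+1 then F (sync_iter k' (phiV m), omega m) else v0.

Hypothesis phiK : cancel phi phiV.
Hypothesis V_invariant : state_invariant F V (range omega).
Hypothesis c01 : 0 < c < 1.
Hypothesis F_contracting : forall x1 x2 z, V x1 -> V x2 -> range omega z ->
  enorm (F (x1, z) - F (x2, z)) <= c * enorm (x1 - x2).

Let c0 : 0 <= c. Proof. by case/andP: c01 => /ltW. Qed.
Let c0lt1 : 0 <= c < 1. Proof. by rewrite c0; case/andP: c01. Qed.
Let rangeP m : range omega (omega m). Proof. by exists m. Qed.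

Lemma ziterP (t : int) m :
  ziter phi phiV (t - 1) m = phiV (ziter phi phiV t m).
Proof.
case: t => [[//|k]|k].
- have -> : Posz k.+1 - 1 = Posz k by rewrite intS addrC addKr.
  by rewrite /= phiK.
- have -> : Negz k - 1 = Negz k.+1 by rewrite !NegzE [in RHS]intS opprD addrC.
  by [].
Qed.

(** Two solutions at distance at most [s] are at distance at most [c s];
    boundedness provides an [s] to start from. *)
Lemma bounded_solution_unique m x y :
  bounded_maps_into V int x -> bounded_maps_into V int y ->
  state_solution phi phiV omega F m x -> state_solution phi phiV omega F m y ->
  x = y.
Proof.
move=> [Vx /bounded_fun_rVP[Kx xK]] [Vy /bounded_fun_rVP[Ky yK]] xS yS.
pose Q s := forall t, enorm (x t - y t) <= s.
have Qe : forall e, 0 < e -> Q e.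
  apply: (@contraction_all _ Q c (Num.sqrt N%:R * (Kx + Ky))) => //.
  - by move=> s t st Qs u; exact: le_trans (Qs u) st.
  - move=> t; apply: le_trans (enorm_le_norm _) _.
    by rewrite ler_wpM2l ?sqrtr_ge0// (le_trans (ler_normB _ _))// lerD.
  move=> s e s0 e0 Qs t; rewrite xS yS.
  apply: le_trans (F_contracting _ _ _) _ => //.
  by rewrite (le_trans (ler_wpM2l c0 (Qs _)))// lerDl ltW.
apply/funext => t; apply/eqP; rewrite -subr_eq0 -normr_le0.
apply/ler_addgt0Pl => e e0; rewrite addr0.
exact: le_trans (norm_le_enorm _) (Qe _ e0 t).
Qed.

Hypotheses (M_compact : compact [set: M]) (phiV_continuous : continuous phiV).
Hypotheses (omega_continuous : continuous omega) (F_continuous : continuous F).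
Hypotheses (Vv0 : V v0) (V_closed : closed V).

Lemma sync_iter_in k m : V (sync_iter k m).
Proof. by elim: k m => [//|k IH] m /=; exact: V_invariant. Qed.

Lemma sync_iter_continuous k : continuous (sync_iter k).
Proof.
elim: k => [|k IH] m /=; first exact: cvg_cst.
apply: (@continuous_comp _ _ _ (fun m => (sync_iter k (phiV m), omega m)) F).
  have fphi : sync_iter k (phiV x) @[x --> m] --> sync_iter k (phiV m).
    by apply: continuous_comp; [exact: phiV_continuous|exact: IH].
  exact: (cvg_pair fphi (@omega_continuous m)).
exact: F_continuous.
Qed.

Lemma sync_iter_bounded : exists r, forall k m, enorm (sync_iter k m - v0) <= r.
Proof.
have /bounded_fun_rVP[B FB] : bounded_fun (fun m => F (v0, omega m) - v0).
  apply: compact_bounded_fun => // m; apply: cvgB; last exact: cvg_cst.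
  apply: (@continuous_comp _ _ _ (fun m => (v0, omega m)) F).
    exact: (cvg_pair (cvg_cst v0) (@omega_continuous m)).
  exact: F_continuous.
pose b := Num.sqrt N%:R * `|B|.
have b0 : 0 <= b by rewrite mulr_ge0// sqrtr_ge0.
have c1 : 0 < 1 - c by rewrite subr_gt0; case/andP: c01.
(* [r] solves [r = c r + b], so that the ball of radius [r] is invariant. *)
exists (b / (1 - c)); elim=> [|k IH] m.
  by rewrite subrr enorm0 divr_ge0// ltW.
have -> : b / (1 - c) = c * (b / (1 - c)) + b by field; rewrite gt_eqF.
apply: le_trans (enorm_triangle _ (F (v0, omega m)) _) _; apply: lerD.
  apply: le_trans (F_contracting _ _ _) _ => //; first exact: sync_iter_in.
  by rewrite ler_wpM2l.
apply: le_trans (enorm_le_norm _) _; rewrite ler_wpM2l ?sqrtr_ge0//.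
exact: le_trans (FB m) (ler_norm _).
Qed.

(** If all iterates from some rank on are within [s] of each other, those from
    the next rank on are within [c s]; boundedness provides the first [s]. *)
Lemma sync_iter_cauchy e : 0 < e -> exists n, forall k l,
  (n <= k)%N -> (n <= l)%N -> forall m, enorm (sync_iter l m - sync_iter k m) <= e.
Proof.
have [r fr] := sync_iter_bounded.
move: e; apply: (@contraction_all _ _ c (r + r)) => //.
- move=> s t st [n Qs]; exists n => k l nk nl m.
  exact: le_trans (Qs k l nk nl m) st.
- exists 0%N => k l _ _ m; apply: le_trans (enorm_triangle _ v0 _) _.
  by apply: lerD => //; rewrite enormC.
move=> s e s0 e0 [n Qs]; exists n.+1 => -[//|k] [//|l] nk nl m /=.
apply: le_trans (F_contracting _ _ _) _ => //; [exact: sync_iter_in..|].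
by rewrite (le_trans (ler_wpM2l c0 (Qs _ _ _ _ _)))// lerDl ltW.
Qed.

Lemma sync_limit : exists f : M -> 'rV[R]_N,
  [/\ continuous f, bounded_maps_into V M f,
      forall m, f m = F (f (phiV m), omega m)
    & forall e, 0 < e -> exists n, forall k, (n <= k)%N ->
        forall m, `|f m - sync_iter k m| <= e].
Proof.
have [|e e0|f flim'] := @uniform_limit R M N (fun=> 1) sync_iter; first by [].
  have [n fn] := sync_iter_cauchy e0; exists n => k l nk nl m.
  by rewrite mulr1 (le_trans (norm_le_enorm _))// fn.
have flim e : 0 < e -> exists n, forall k, (n <= k)%N ->
    forall m, `|f m - sync_iter k m| <= e.
  by move=> /flim'[n fn]; exists n => k nk m; rewrite -[e]mulr1 fn.
have Vf m : V (f m).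
  apply: (@closed_cvg _ _ \oo _ (fun k => sync_iter k m) V) => //.
    by near=> k; exact: sync_iter_in.
  by apply/cvgrPdist_le => e /flim[n fn]; exists n => // k /= nk; exact: fn.
have cf : continuous f.
  move=> m; apply: continuous_limit => e /flim[n fn]; exists (sync_iter n).
    exact: sync_iter_continuous.
  by near=> y; exact: fn.
exists f; split => //; first by split => //; exact: compact_bounded_fun.
move=> m; apply/eqP; rewrite -subr_eq0 -normr_le0.
apply/ler_addgt0Pl => e e0; rewrite addr0.
(* [f] is within [e'] of [f_n] and of [f_(n+1)], where
   [e' = e / (1 + sqrt N)] absorbs the comparison of the two norms. *)
have s0 : 0 < 1 + Num.sqrt N%:R :> R by rewrite ltr_pwDl// sqrtr_ge0.
have [n fn] := flim (e / (1 + Num.sqrt N%:R)) (divr_gt0 e0 s0).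
rewrite -(subrKA (sync_iter n.+1 m)) (le_trans (ler_normD _ _))//.
have -> : e = e / (1 + Num.sqrt N%:R) + Num.sqrt N%:R * (e / (1 + Num.sqrt N%:R)).
  by field; rewrite gt_eqF.
apply: lerD; first by apply: fn.
apply: le_trans (norm_le_enorm _) _; apply: le_trans (F_contracting _ _ _) _ => //.
  exact: sync_iter_in.
have [_ /ltW c1] := andP c01.
rewrite (le_trans (ler_piMl (enorm_ge0 _) c1))// (le_trans (enorm_le_norm _))//.
by rewrite ler_wpM2l ?sqrtr_ge0// distrC fn.
Unshelve. all: by end_near. Qed.

(** Along an orbit, a map satisfying the identity is a solution; so both the
    value of the generalized synchronization and its uniqueness come from the
    uniqueness of bounded solutions. *)
Lemma synchronizesP f : continuous f -> bounded_maps_into V M f ->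
  (forall m, f m = F (f (phiV m), omega m)) ->
  generalized_synchronization phi phiV omega F (bounded_maps_into V) = f /\
  synchronizes phi phiV omega F (bounded_maps_into V).
Proof.
move=> cf bf f_fix.
have orbit (h : M -> 'rV[R]_N) m : bounded_maps_into V M h ->
    (forall m, h m = F (h (phiV m), omega m)) ->
    bounded_maps_into V int (fun t => h (ziter phi phiV t m)) /\
    state_solution phi phiV omega F m (fun t => h (ziter phi phiV t m)).
  move=> [Vh /bounded_fun_rVP[K hK]] h_fix; split; last first.
    by move=> t /=; rewrite ziterP -h_fix.
  by split=> [t|]; [exact: Vh|apply/bounded_fun_rVP; exists K => t].
have uniq m x : bounded_maps_into V int x /\ state_solution phi phiV omega F m x ->
    x = fun t => f (ziter phi phiV t m).
  by move=> [bx xS]; have [bf' fS] := orbit f m bf f_fix; exact: bounded_solution_unique xS fS.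
have gsE : generalized_synchronization phi phiV omega F (bounded_maps_into V) = f.
  apply/funext => m; rewrite /generalized_synchronization.
  rewrite (@xget_unique _ _ _ (fun t => f (ziter phi phiV t m)))//.
    exact: orbit.
  by move=> y /uniq.
split=> //; rewrite /synchronizes gsE; split => //.
  move=> m; exists (fun t => f (ziter phi phiV t m)); split; first exact: orbit.
  by move=> x /uniq.
move=> h bh h_fix; apply/funext => m.
by have /uniq/(congr1 (fun x => x 0)) := orbit h m bh h_fix.
Qed.

End Synchronization.

(** * Continuously differentiable maps *)

Lemma is_diffP (R : realType) (U W : normedModType R) (f : U -> W)
    (df : {linear U -> W}) x :
  continuous df ->
  (forall e, 0 < e -> \forall v \near 0, `|f (x + v) - f x - df v| <= e * `|v|) ->
  is_diff x f df.
Proof.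
move=> cdf fdf.
have fE : f \o shift x = cst (f x) + df +o_ 0 id.
  apply/eqaddoP => e e0; have := fdf e e0; apply: filterS => v.
  by rewrite !fctE /= opprD addrA [x + v]addrC.
have dE := diff_unique cdf fE.
have df1 : differentiable f x by apply/diff_locallyP; rewrite dE.
exact: DiffDef df1 dE.
Qed.

Lemma differentiable_near (R : realType) (U W : normedModType R) (f : U -> W) x e :
  differentiable f x -> 0 < e ->
  \forall v \near 0, `|f (x + v) - f x - 'd f x v| <= e * `|v|.
Proof.
move=> /diff_locally /eqaddoP fE e0; have := fE e e0; apply: filterS => v.
by rewrite !fctE /= opprD addrA [v + x]addrC.
Qed.

Lemma near_eq_is_diff (R : realType) (U W : normedModType R) (f g : U -> W) x :
  (\forall y \near x, f y = g y) -> differentiable g x -> is_diff x f ('d g x).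
Proof.
move=> fg dg; apply: is_diffP; first exact: diff_continuous.
move=> e e0; have fg0 : \forall v \near 0, f (v + (x - 0)) = g (v + (x - 0)).
  by move: fg; rewrite (near_shift 0).
have := differentiable_near dg e0; apply: filterS2 fg0 => v.
by rewrite subr0 [v + x]addrC (nbhs_singleton fg) => ->.
Qed.

(** A basis whose coordinates are bounded by the norm, as for the sup norm on
    row vectors and on pairs. *)
Definition finite_basis (R : realType) (U : normedModType R) (I : finType)
    (e : I -> U) (co : I -> U -> R) : Prop :=
  (forall v, v = \sum_i co i v *: e i) /\ (forall i v, `|co i v| <= `|v|).

Lemma finite_basis_rV (R : realType) n :
  finite_basis (fun i : 'I_n => delta_mx 0 i : 'rV[R]_n) (fun i v => v 0 i).
Proof. by split=> [v|i v]; [exact: row_sum_delta|exact: coord_le_norm]. Qed.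

Lemma finite_basis_prod (R : realType) (U W : normedModType R) (I J : finType)
    (eU : I -> U) (cU : I -> U -> R) (eW : J -> W) (cW : J -> W -> R) :
  finite_basis eU cU -> finite_basis eW cW ->
  finite_basis (fun k : I + J => match k return (U * W)%type with
                                 | inl i => (eU i, 0) | inr j => (0, eW j) end)
    (fun k v => match k with inl i => cU i v.1 | inr j => cW j v.2 end).
Proof.
move=> [UE Ule] [WE Wle]; split=> [[u w]|[i|j] [u w]] /=; last 2 first.
- by rewrite (le_trans (Ule _ _))// prod_normE le_max lexx.
- by rewrite (le_trans (Wle _ _))// prod_normE le_max lexx orbT.
rewrite big_sumType/=.
have -> : \sum_i cU i u *: (eU i, 0 : W) = (\sum_i cU i u *: eU i, 0).
  rewrite (big_morph (fun x => (x, 0 : W)) (id1 := 0) (op1 := +%R)) //; last first.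
    by move=> x y; rewrite -[0 in LHS]addr0.
  by apply: eq_bigr => i _; rewrite -[0 in RHS](scaler0 _ (cU i u)).
have -> : \sum_j cW j w *: (0 : U, eW j) = (0, \sum_j cW j w *: eW j).
  rewrite (big_morph (fun x => (0 : U, x)) (id1 := 0) (op1 := +%R)) //; last first.
    by move=> x y; rewrite -[0 in LHS]addr0.
  by apply: eq_bigr => i _; rewrite -[0 in RHS](scaler0 _ (cW i w)).
by rewrite -UE -WE; congr pair; rewrite /= ?addr0 ?add0r.
Qed.

(** In finite dimension the pointwise continuity of the differential is
    continuity for the operator norm. *)
Lemma diff_op_continuous (R : realType) (U W : normedModType R) (I : finType)
    (e : I -> U) (co : I -> U -> R) (f : U -> W) x :
  finite_basis e co -> (forall v, {for x, continuous (fun y => 'd f y v)}) ->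
  forall eps, 0 < eps ->
    \forall y \near x, forall v, `|'d f y v - 'd f x v| <= eps * `|v|.
Proof.
move=> [eE cole] dfc eps eps0.
pose eps' := eps / (#|I|%:R + 1).
have I0 : 0 < #|I|%:R + 1 :> R by rewrite ltr_wpDl.
have eps'0 : 0 < eps' by rewrite divr_gt0.
have dfe : \forall y \near x, forall i, `|'d f y (e i) - 'd f x (e i)| <= eps'.
  apply: filter_forall => i; have /cvgrPdist_le/(_ _ eps'0) := dfc (e i).
  by apply: filterS => y; rewrite distrC.
apply: filterS dfe => y dfe v.
have dfE y' : 'd f y' v = \sum_i co i v *: 'd f y' (e i).
  by rewrite {1}(eE v) linear_sum; apply: eq_bigr => i _; rewrite linearZ.
rewrite !dfE -sumrB (le_trans (ler_norm_sum _ _ _))//.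
(* The extra summand accounts for the [+ 1] in [eps'], which covers [I] empty. *)
have -> : eps * `|v| = \sum_(i : I) eps' * `|v| + eps' * `|v|.
  rewrite sumr_const -[_ *+ #|I|]mulr_natl /eps'; field; exact: lt0r_neq0.
apply: ler_wpDr; first by rewrite mulr_ge0// ltW.
apply: ler_sum => i _; rewrite -scalerBr normrZ mulrC.
by apply: ler_pM.
Qed.

Lemma diff_bound (R : realType) (U W : normedModType R) (f : U -> W) x :
  continuous ('d f x) -> exists2 C, 0 <= C & forall v, `|'d f x v| <= C * `|v|.
Proof.
by move=> /linear_lipschitz[C C0 fC]; exists C => //; exact: ltW.
Qed.

(** The differential is jointly continuous in the base point and the vector:
    operator norm continuity controls the first, linearity the second. *)
Lemma cvg_diff (R : realType) (U W : normedModType R) (I : finType)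
    (e : I -> U) (co : I -> U -> R) (f : U -> W)
    (X : topologicalType) (p w : X -> U) x :
  finite_basis e co -> differentiable f (p x) ->
  (forall v, {for p x, continuous (fun y => 'd f y v)}) ->
  {for x, continuous p} -> {for x, continuous w} ->
  {for x, continuous (fun y => 'd f (p y) (w y))}.
Proof.
move=> fb df dfc pc wc; apply/cvgrPdist_le => eps eps0.
have eps2 : 0 < eps / 2 by rewrite divr_gt0.
have w0 : 0 < `|w x| + 1 by rewrite ltr_wpDl.
have dwc : 'd f (p x) (w y) @[y --> x] --> 'd f (p x) (w x).
  by apply: continuous_comp; [exact: wc|exact: diff_continuous].
have op : \forall y \near p x, forall v,
    `|'d f y v - 'd f (p x) v| <= eps / 2 / (`|w x| + 1) * `|v|.
  by apply: (diff_op_continuous fb dfc); rewrite divr_gt0.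
have {}op := pc _ op.
have /cvgrPdist_le/(_ _ eps2) dwc2 := dwc.
have wb : \forall y \near x, `|w y| <= `|w x| + 1.
  have /cvgrPdist_le/(_ _ ltr01) := wc; apply: filterS => y wy.
  by rewrite -lerBlDl (le_trans (lerB_dist _ _))// distrC.
near=> y.
rewrite -(subrKA ('d f (p x) (w y))) (le_trans (ler_normD _ _))//.
have -> : eps = eps / 2 + eps / 2 / (`|w x| + 1) * (`|w x| + 1).
  by field; rewrite gt_eqF.
apply: lerD; first by near: y.
rewrite distrC; have opy : forall v,
  `|'d f (p y) v - 'd f (p x) v| <= eps / 2 / (`|w x| + 1) * `|v| by near: y.
apply: le_trans (opy _) _; apply: ler_wpM2l; last by near: y.
by apply: divr_ge0; exact: ltW.
Unshelve. all: by end_near. Qed.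

(** Applied coordinatewise, the scalar mean value theorem gives the estimate in
    the sup norm. *)
Lemma mean_value_ineq (R : realType) (U : normedModType R) N
    (h : U -> 'rV[R]_N) u v (C : R) :
  (forall t, 0 <= t <= 1 -> differentiable h (u + t *: v)) ->
  (forall t, 0 <= t <= 1 -> `|'d h (u + t *: v) v| <= C) ->
  `|h (u + v) - h u| <= C.
Proof.
move=> dh hC; have C0 : 0 <= C by apply: le_trans (hC 0 _); rewrite ?lexx ?ler01.
apply: norm_le_coord => // i.
pose l (t : R) := u + t *: v; pose g (t : R) : R := h (l t) 0 i.
have dg (t : R) : 0 <= t <= 1 -> is_derive t 1 g ('d h (l t) v 0 i).
  move=> t01; have dl : is_diff t l (fun s => s *: v).
    by apply: is_diff_eq; rewrite add0r.
  have dhl : is_diff t (h \o l) ('d h (l t) \o (fun s => s *: v)).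
    by apply: is_diff_comp; exact/differentiableP/dh.
  have dhl1 : derivable (h \o l) t 1 by exact: diff_derivable.
  have := derive_mx dhl1; rewrite deriveE// diff_val/= scale1r.
  move=> /matrixP/(_ 0 i); rewrite mxE => ->; apply/derivableP.
  by move/derivable_mxP : dhl1 => /(_ 0 i).
have gc : {within `[0, 1], continuous g}.
  apply: derivable_within_continuous => t; rewrite in_itv/= => /dg dgt.
  exact: ex_derive.
have [|t t01] := @MVT_segment R g (fun t => 'd h (l t) v 0 i) 0 1 ler01 _ gc.
  by move=> t; rewrite in_itv/= => /andP[t0 t1]; apply: dg; rewrite !ltW.
rewrite subr0 mulr1 /g /l scale1r scale0r addr0 !mxE => ->.
by rewrite (le_trans (coord_le_norm _ _ _))// hC.
Qed.

(** * Limits of C^1 maps *)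

Lemma segment_ball (R : realType) (U : normedModType R) (u0 u v : U) r t :
  ball u0 r u -> ball u0 r (u + v) -> 0 <= t <= 1 -> ball u0 r (u + t *: v).
Proof.
rewrite -!ball_normE/= => ru ruv /andP[t0 t1].
have -> : u0 - (u + t *: v) = (1 - t) *: (u0 - u) + t *: (u0 - (u + v)).
  by rewrite !opprD !addrA (scalerBr t) addrA -scalerDl subrK scale1r.
rewrite (le_lt_trans (ler_normD _ _))// !normrZ !ger0_norm ?subr_ge0//.
have [->|t0'] := eqVneq t 0; first by rewrite subr0 mul1r mul0r addr0.
have -> : r = (1 - t) * r + t * r by ring.
apply: ler_ltD; first by rewrite ler_wpM2l ?subr_ge0// ltW.
by rewrite ltr_pM2l// lt0r t0'.
Qed.

(** The mean value inequality applied to [h l - h k] turns the uniform Cauchy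
    property of the differentials into one for the difference quotients, so
    that the limits of the differentials are the differentials of the limit. *)
Lemma C1_limit (R : realType) n N (D : set 'rV[R]_n)
    (h : nat -> 'rV[R]_n -> 'rV[R]_N) (f : 'rV[R]_n -> 'rV[R]_N) :
  open D -> (forall k, Ck 1 D (h k)) ->
  (forall u, D u -> h k u @[k --> \oo] --> f u) ->
  (forall u0, D u0 -> exists2 B, nbhs u0 B & forall e, 0 < e ->
     exists K, forall k l, (K <= k)%N -> (K <= l)%N -> forall u, B u ->
       forall v, `|'d (h l) u v - 'd (h k) u v| <= e * `|v|) ->
  Ck 1 D f.
Proof.
move=> oD hC1 hf dhC.
suff loc u0 : D u0 -> differentiable f u0 /\
    forall v, {for u0, continuous (fun u => 'd f u v)}.
  by split=> [u /loc[]//|v u /loc[]].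
move=> Du0; have [B nB dhB] := dhC u0 Du0.
have [r /= r0 rBD] : exists2 r, 0 < r & ball u0 r `<=` B `&` D.
  have : nbhs u0 (B `&` D) by apply: filterI => //; exact: open_nbhs_nbhs.
  by move=> /nbhs_ballP[r r0 rBD]; exists r.
have rB u : ball u0 r u -> B u by move=> /rBD[].
have rD u : ball u0 r u -> D u by move=> /rBD[].
(* The limits [G u] of the differentials, uniform for the weight [|v|]. *)
have [|e e0|G' G'lim] := @uniform_limit R ({u | ball u0 r u} * 'rV[R]_n)%type N
    (fun x => `|x.2|) (fun k x => 'd (h k) (sval x.1) x.2).
- by [].
- have [K dhK] := dhB e e0; exists K => k l Kk Kl [[u ru] v] /=.
  exact: dhK (rB _ ru) _.
pose G (u v : 'rV[R]_n) : 'rV[R]_N :=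
  if pselect (ball u0 r u) is left ru then G' (exist _ u ru, v) else 0.
have Glim e : 0 < e -> exists K, forall k, (K <= k)%N -> forall u, ball u0 r u ->
    forall v, `|G u v - 'd (h k) u v| <= e * `|v|.
  move=> /G'lim[K GK]; exists K => k Kk u ru v; rewrite /G.
  by case: pselect => // ru'; exact: (GK k Kk (exist _ u ru', v)).
clearbody G; clear G' G'lim.
have Gcvg u v : ball u0 r u -> 'd (h k) u v @[k --> \oo] --> G u v.
  move=> ru; apply/cvgrPdist_le => e e0.
  have v1 : 0 < `|v| + 1 by rewrite ltr_wpDl.
  have [K GK] := Glim (e / (`|v| + 1)) (divr_gt0 e0 v1).
  exists K => // k /= Kk; apply: le_trans (GK k Kk u ru v) _.
  by rewrite mulrAC ler_pdivrMr// ler_pM2l// lerDl.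
have Glin u : ball u0 r u -> linear (G u).
  move=> ru a v w; apply: (cvg_unique _ (Gcvg u (a *: v + w) ru)) => //.
  have -> : (fun k => 'd (h k) u (a *: v + w)) =
      (fun k => a *: 'd (h k) u v + 'd (h k) u w).
    by apply/funext => k; rewrite linearP.
  by apply: cvgD; [apply: cvgZr; exact: Gcvg|exact: Gcvg].
have dG (u : 'rV[R]_n) : ball u0 r u -> is_diff u f (G u).
  move=> ru; pose lG : {linear 'rV[R]_n -> 'rV[R]_N} :=
    HB.pack (G u) (GRing.isLinear.Build _ _ _ _ _ (Glin u ru)).
  have dh k : differentiable (h k) u by apply: (hC1 k).1; exact: rD.
  apply: (@is_diffP _ _ _ f lG).
    have [K GK] := Glim 1 ltr01.
    have [C C0 dhKC] := diff_bound (diff_continuous (dh K)).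
    apply: bounded_linear_continuous; apply/ex_bound; exists (C + 1).
    have : nbhs (0 : 'rV[R]_n) (ball 0 1) by exact: nbhsx_ballx.
    apply: filterS => v; rewrite -ball_normE/= sub0r normrN => /ltW v1.
    rewrite -(subrK ('d (h K) u v) (G u v)) (le_trans (ler_normD _ _))//.
    rewrite [C + 1]addrC lerD//.
      by rewrite (le_trans (GK K (leqnn K) u ru v))// mul1r.
    by rewrite (le_trans (dhKC v))// ler_piMr.
  move=> e e0 /=; have e4 : 0 < e / 4 by rewrite divr_gt0.
  have [K1 GK] := Glim _ e4; have [K2 dhK] := dhB _ e4.
  pose K := maxn K1 K2.
  have near_r : \forall v \near (0 : 'rV[R]_n), ball u0 r (u + v).
    have : nbhs u (ball u0 r) by apply: open_nbhs_nbhs; split => //; exact: ball_open.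
    move=> ru'; have : \forall v \near u, ball u0 r v by exact: ru'.
    rewrite (near_shift 0) subr0 => ru0; near=> v; rewrite addrC.
    by near: v; exact: ru0.
  have near_h := differentiable_near (dh K) e4.
  apply: filterS2 near_r near_h => v ruv hKv.
  (* The mean value inequality for [h l - h K], in the limit [l -> oo]. *)
  have fh : `|(f (u + v) - f u) - (h K (u + v) - h K u)| <= e / 4 * `|v|.
    have cvgN : `|(h l (u + v) - h l u) - (h K (u + v) - h K u)| @[l --> \oo] -->
        `|(f (u + v) - f u) - (h K (u + v) - h K u)|.
      by apply: cvg_norm; apply: cvgB; [apply: cvgB; apply: hf; exact: rD|exact: cvg_cst].
    apply: (cvgr_to_le cvgN); exists K => // l /= Kl.
    have -> : h l (u + v) - h l u - (h K (u + v) - h K u) =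
        (h l - h K) (u + v) - (h l - h K) u.
      by rewrite !fctE/= !opprD !opprK addrACA.
    have dlK t : 0 <= t <= 1 -> is_diff (u + t *: v) (h l - h K)
        (('d (h l) (u + t *: v) : 'rV[R]_n -> 'rV[R]_N) -
         ('d (h K) (u + t *: v) : 'rV[R]_n -> 'rV[R]_N)).
      move=> t01; have Dt : D (u + t *: v) by apply/rD/segment_ball.
      by apply: is_diffB; apply/differentiableP/(hC1 _).1.
    apply: mean_value_ineq => t t01; have := dlK t t01 => dlKt.
      exact: ex_diff.
    rewrite diff_val; apply: dhK; rewrite ?leq_maxr//.
      by rewrite (leq_trans _ Kl)// leq_maxr.
    by apply/rB/segment_ball.
  have GKv := GK K (leq_maxl _ _) u ru v.
  have -> : f (u + v) - f u - G u v = ((f (u + v) - f u) - (h K (u + v) - h K u)) +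
      (h K (u + v) - h K u - 'd (h K) u v) + ('d (h K) u v - G u v).
    by rewrite !subrKA.
  rewrite (le_trans (ler_normD _ _))// (le_trans (lerD (ler_normD _ _) (lexx _)))//.
  rewrite [`|'d _ _ _ - _|]distrC.
  apply: le_trans (lerD (lerD fh hKv) GKv) _.
  have ev0 : 0 <= e / 4 * `|v| by rewrite mulr_ge0// ltW.
  by rewrite -!mulrDl ler_wpM2r//; lra.
split; first by have := dG u0 (ballxx _ r0) => ?; exact: ex_diff.
move=> v; apply: continuous_limit => e e0.
have v1 : 0 < `|v| + 1 by rewrite ltr_wpDl.
have [K GK] := Glim (e / (`|v| + 1)) (divr_gt0 e0 v1).
exists (fun u => 'd (h K) u v); first by apply: (hC1 K).2; exact: Du0.
near=> u.
have ru : ball u0 r u by near: u; exact: nbhsx_ballx.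
have [_ dfu] := dG u ru.
have dfuv : 'd f u v = G u v by exact: (congr1 (fun k => k v) dfu).
rewrite [X in X - _]dfuv.
apply: le_trans (GK K (leqnn K) u ru v) _.
by rewrite mulrAC ler_pdivrMr// ler_pM2l// lerDl.
Unshelve. all: by end_near. Qed.

(** * Operations on C^1 maps *)

Lemma Ck1_comp (R : realType) (U W X : normedModType R) (J : finType)
    (eW : J -> W) (cW : J -> W -> R) (D : set U) (E : set W) (f : U -> W) (g : W -> X) :
  finite_basis eW cW -> open D -> Ck 1 D f -> Ck 1 E g -> (forall x, D x -> E (f x)) ->
  Ck 1 D (g \o f).
Proof.
move=> fb oD [df cdf] [dg cdg] fDE; split=> [x Dx|v x Dx].
  by apply: differentiable_comp; [exact: df|exact/dg/fDE].
have dcomp : \forall y \near x, 'd g (f y) ('d f y v) = 'd (g \o f) y v.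
  have : nbhs x D by exact: open_nbhs_nbhs.
  by apply: filterS => y Dy; rewrite (diff_comp (df y Dy) (dg _ (fDE y Dy))).
rewrite /prop_for/continuous_at -(nbhs_singleton dcomp).
apply: (cvg_trans _ (cvg_diff fb (dg _ (fDE _ Dx)) _ _ (cdf v x Dx))).
- exact: near_eq_cvg.
- by move=> w; apply: cdg; exact: fDE.
- exact/differentiable_continuous/df.
Qed.

Lemma Ck1_pair (R : realType) (U W X : normedModType R) (D : set U)
    (f : U -> W) (g : U -> X) :
  open D -> Ck 1 D f -> Ck 1 D g -> Ck 1 D (fun x => (f x, g x)).
Proof.
move=> oD [df cdf] [dg cdg]; split=> [x Dx|v x Dx].
  by apply: differentiable_pair; [exact: df|exact: dg].
have dpair : \forall y \near x, ('d f y v, 'd g y v) = 'd (fun x => (f x, g x)) y v.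
  have : nbhs x D by exact: open_nbhs_nbhs.
  by apply: filterS => y Dy; rewrite (diff_pair (df y Dy) (dg y Dy)).
rewrite /prop_for/continuous_at -(nbhs_singleton dpair).
apply: (cvg_trans _ (cvg_pair (cdf v x Dx) (cdg v x Dx))).
exact: near_eq_cvg.
Qed.

Lemma Ck1_local (R : realType) (U W : normedModType R) (D : set U) (f : U -> W) :
  (forall x, D x -> exists (E : set U) (g : U -> W),
     [/\ open E, E x, Ck 1 E g & forall y, E y -> f y = g y]) ->
  Ck 1 D f.
Proof.
move=> loc; split=> [x|v x] /loc[E [g [oE Ex [dg cdg] fg]]].
  have fgx : \forall y \near x, f y = g y.
    by apply: filterS (open_nbhs_nbhs (conj oE Ex)).
  by have [] := near_eq_is_diff fgx (dg x Ex).
have dfg y : E y -> 'd g y v = 'd f y v.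
  move=> Ey; have fgy : \forall z \near y, f z = g z.
    by apply: filterS (open_nbhs_nbhs (conj oE Ey)).
  have [_ dE] := near_eq_is_diff fgy (dg y Ey).
  by have := congr1 (fun k => k v) dE.
rewrite /prop_for/continuous_at -(dfg x Ex).
apply: (cvg_trans _ (cdg v x Ex)); apply: near_eq_cvg.
by apply: filterS (open_nbhs_nbhs (conj oE Ex)).
Qed.

Lemma Ck1_sub (R : realType) (U W : normedModType R) (D E : set U) (f : U -> W) :
  D `<=` E -> Ck 1 E f -> Ck 1 D f.
Proof. by move=> DE [df cdf]; split=> [x /DE/df//|v x /DE/cdf]. Qed.

(** * Maps read in charts *)

Section Charts.
Variables (R : realType) (M : topologicalType) (n : nat).
Implicit Types (c : chart R M n) (m : M) (psi : M -> M).

Lemma cinv_cvg c u : cimg c u -> {for u, continuous (cinv c)}.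
Proof.
move=> cu; have := @cinv_continuous _ _ _ c.
rewrite continuous_open_subspace; last exact: cimg_open.
by apply; rewrite inE.
Qed.

Lemma cmap_cvg c m : cdom c m -> {for m, continuous (cmap c)}.
Proof.
move=> cm; have := @cmap_continuous _ _ _ c.
rewrite continuous_open_subspace; last exact: cdom_open.
by apply; rewrite inE.
Qed.

Lemma in_charts_dom_open psi c c' : continuous psi -> open (in_charts_dom psi c c').
Proof.
move=> cpsi; rewrite openE => u [cu c'u]; apply: filterI.
  by apply: open_nbhs_nbhs; split => //; exact: cimg_open.
have cpu : {for u, continuous (psi \o cinv c)}.
  by apply: continuous_comp; [exact: cinv_cvg|exact: cpsi].
by apply: cpu; apply: open_nbhs_nbhs; split => //; exact: cdom_open.
Qed.

Lemma in_charts_domP psi c c' m :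
  cdom c m -> cdom c' (psi m) -> in_charts_dom psi c c' (cmap c m).
Proof.
move=> cm c'm; split; first exact: cmap_img.
by rewrite /= cmapK.
Qed.

(** The chain rule for [f \o psi], read in a chart [c] around [m] and a chart
    [c'] around [psi m]. *)
Lemma is_diff_in_charts k (f : M -> 'rV[R]_k) psi c c' m :
  continuous psi -> cdom c m -> cdom c' (psi m) ->
  differentiable (in_charts psi c c') (cmap c m) ->
  differentiable (f \o cinv c') (cmap c' (psi m)) ->
  is_diff (cmap c m) (f \o psi \o cinv c)
    ('d (f \o cinv c') (cmap c' (psi m)) \o tangent_map psi c c' m).
Proof.
move=> cpsi cm c'm dpsi df.
have fE : \forall u \near cmap c m,
    (f \o psi \o cinv c) u = ((f \o cinv c') \o in_charts psi c c') u.
  have : nbhs (cmap c m) (in_charts_dom psi c c').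
    apply: open_nbhs_nbhs; split; last exact: in_charts_domP.
    exact: in_charts_dom_open.
  by apply: filterS => u [cu c'u] /=; rewrite /in_charts/= cmapK.
have psiE : in_charts psi c c' (cmap c m) = cmap c' (psi m).
  by rewrite /in_charts/= cmapK.
have df' : differentiable (f \o cinv c') (in_charts psi c c' (cmap c m)).
  by rewrite psiE.
have [dfpsi dE] := near_eq_is_diff fE (differentiable_comp dpsi df').
by rewrite -psiE; exact: DiffDef dfpsi (etrans dE (diff_comp dpsi df')).
Qed.

End Charts.

(** * Riemannian norms in charts *)

Section Riemannian.
Variables (R : realType) (M : topologicalType) (n : nat).

Lemma quad_formE (A : 'M[R]_n) (v : 'rV[R]_n) :
  (v *m A *m v^T) 0 0 = \sum_j (\sum_i v 0 i * A i j) * v 0 j.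
Proof. by rewrite mxE; apply: eq_bigr => j _; rewrite !mxE. Qed.

Lemma quad_form_le (A : 'M[R]_n) (v : 'rV[R]_n) :
  `|(v *m A *m v^T) 0 0| <= n%:R ^+ 2 * `|A| * `|v| ^+ 2.
Proof.
have -> : n%:R ^+ 2 * `|A| * `|v| ^+ 2 =
    \sum_(j < n) (\sum_(i < n) `|v| * `|A|) * `|v|.
  by rewrite !sumr_const !card_ord; ring.
rewrite quad_formE (le_trans (ler_norm_sum _ _ _))//; apply: ler_sum => j _.
rewrite normrM; apply: ler_pM => //; last exact: coord_le_norm.
rewrite (le_trans (ler_norm_sum _ _ _))//; apply: ler_sum => i _.
by rewrite normrM; apply: ler_pM => //; exact: coord_le_norm.
Qed.

Lemma quad_form_continuous (A : 'M[R]_n) :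
  continuous (fun v : 'rV[R]_n => (v *m A *m v^T) 0 0).
Proof.
have lin j : continuous (fun v : 'rV[R]_n => \sum_(i < n) v 0 i * A i j : R).
  apply: continuous_big => [|i _ v]; first exact: add_continuous.
  apply: (@cvgM _ _ (nbhs v) _ (fun v : 'rV[R]_n => v 0 i) (fun=> A i j)).
    exact: coord_continuous.
  exact: cvg_cst.
have -> : (fun v : 'rV[R]_n => (v *m A *m v^T) 0 0) =
    (fun v => \sum_(j < n) (\sum_(i < n) v 0 i * A i j) * v 0 j).
  by apply/funext => v; rewrite quad_formE.
apply: continuous_big => [|j _ v]; first exact: add_continuous.
exact: cvgM (lin j v) (@coord_continuous _ _ _ 0 j v).
Qed.

(** By homogeneity, [a] can be taken as the minimum of the form on the compact
    unit sphere; the sphere is empty when [n = 0]. *)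
Lemma posdef_lower (A : 'M[R]_n) :
  (forall v : 'rV[R]_n, v != 0 -> 0 < (v *m A *m v^T) 0 0) ->
  exists2 a : R, 0 < a & forall v : 'rV[R]_n, a * `|v| ^+ 2 <= (v *m A *m v^T) 0 0.
Proof.
move=> Apos; pose S := [set v : 'rV[R]_n | `|v| = 1].
have normalized (v : 'rV[R]_n) : v != 0 -> S (`|v|^-1 *: v).
  move=> v0; rewrite /S/= normrZ ger0_norm ?invr_ge0// mulVf//.
  by rewrite normr_eq0.
have [S0|] := pselect (S !=set0); last first.
  move=> /set0P/negP/negPn/eqP S0; exists 1 => // v.
  have [->|/normalized] := eqVneq v 0; last by rewrite S0.
  by rewrite normr0 expr0n mulr0 mul0mx mul0mx mxE.
have cS : compact S.
  apply: bounded_closed_compact.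
    by exists 1; split=> [|r r1 v /= ->]; [exact: num_real|exact: ltW].
  rewrite (_ : S = (fun v : 'rV[R]_n => `|v|) @^-1` [set 1])//.
  by apply: closed_comp => [v _|]; [exact: norm_continuous|exact: closed_eq].
have [v1 Sv1 v1min] := compact_EVT_min S0 cS
  (continuous_subspaceT (@quad_form_continuous A)).
move: Sv1; rewrite inE => Sv1.
exists ((v1 *m A *m v1^T) 0 0).
  by apply: Apos; rewrite -normr_gt0 Sv1.
move=> v; have [->|v0] := eqVneq v 0.
  by rewrite normr0 expr0n mulr0 mul0mx mul0mx mxE.
have := v1min (`|v|^-1 *: v); rewrite inE => /(_ (normalized v v0)).
rewrite linearZ/= -!scalemxAl -scalemxAr !mxE => le1.
have v_gt0 : 0 < `|v| by rewrite normr_gt0.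
rewrite -ler_pdivlMr ?exprn_gt0//; apply: le_trans le1 _.
by rewrite expr2 invfM mulrA mulrC mulrA.
Qed.

Variables (A : set (chart R M n)) (g : riemannian_metric A).

Lemma tangent_norm_ge0 c m v : 0 <= tangent_norm g c m v.
Proof. exact: sqrtr_ge0. Qed.

Lemma tangent_norm_gt0 c m v : A c -> cdom c m -> v != 0 -> 0 < tangent_norm g c m v.
Proof. by move=> Ac cm v0; rewrite sqrtr_gt0 gram_posdef. Qed.

Lemma gram_cvg c m : A c -> cdom c m -> {for m, continuous (gram g c)}.
Proof.
move=> Ac cm; have := @gram_continuous _ _ _ _ g _ Ac.
rewrite continuous_open_subspace; last exact: cdom_open.
by apply; rewrite inE.
Qed.

Lemma tangent_norm_upper c m0 : A c -> cdom c m0 ->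
  exists2 C, 0 <= C & \forall m \near m0, forall v, tangent_norm g c m v <= C * `|v|.
Proof.
move=> Ac cm0; pose C := n%:R ^+ 2 * (`|gram g c m0| + 1).
have C0 : 0 <= C by rewrite mulr_ge0// addr_ge0.
exists (Num.sqrt C); first exact: sqrtr_ge0.
have /cvgrPdist_le/(_ _ ltr01) := gram_cvg Ac cm0; apply: filterS => m gm v.
rewrite -[`|v|]ger0_norm// -sqrtr_sqr -sqrtrM// ler_wsqrtr//.
rewrite (le_trans (ler_norm _))// (le_trans (quad_form_le _ _))//.
rewrite ler_wpM2r// ler_wpM2l//.
by rewrite -lerBlDl (le_trans (lerB_dist _ _))// distrC.
Qed.

(** The lower bound [a] of the Gram matrix at [m0] persists, halved, as long as
    the Gram matrix moves by at most [e]. *)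
Lemma tangent_norm_lower c m0 : A c -> cdom c m0 ->
  exists2 C, 0 <= C & \forall m \near m0, forall v, `|v| <= C * tangent_norm g c m v.
Proof.
move=> Ac cm0.
have [a a0 qa] := posdef_lower (fun v => @gram_posdef _ _ _ _ g c m0 v Ac cm0).
pose e := a / 2 / (n%:R ^+ 2 + 1).
have n0 : 0 < n%:R ^+ 2 + 1 :> R by rewrite ltr_wpDl.
have e0 : 0 < e by rewrite !divr_gt0.
exists (Num.sqrt (2 / a)); first exact: sqrtr_ge0.
have /cvgrPdist_le/(_ _ e0) := gram_cvg Ac cm0; apply: filterS => m gm v.
have v2 : 0 <= `|v| ^+ 2 by rewrite exprn_ge0.
have qm : a / 2 * `|v| ^+ 2 <= (v *m gram g c m *m v^T) 0 0.
  have -> : (v *m gram g c m *m v^T) 0 0 = (v *m gram g c m0 *m v^T) 0 0 -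
      (v *m (gram g c m0 - gram g c m) *m v^T) 0 0.
    by rewrite mulmxBr mulmxBl !mxE opprB addrC subrK.
  have := qa v; have := quad_form_le (gram g c m0 - gram g c m) v.
  have : n%:R ^+ 2 * `|gram g c m0 - gram g c m| * `|v| ^+ 2 <= a / 2 * `|v| ^+ 2.
    rewrite ler_wpM2r//.
    have -> : a / 2 = (n%:R ^+ 2 + 1) * e by rewrite /e; field; rewrite gt_eqF.
    by rewrite ler_pM// lerDl.
  have := ler_norm ((v *m (gram g c m0 - gram g c m) *m v^T) 0 0).
  set X := (v *m (_ - _) *m _) 0 0.
  lra.
have a2 : 0 <= 2 / a by rewrite divr_ge0// ltW.
rewrite -[`|v|]ger0_norm// -sqrtr_sqr -sqrtrM// ler_wsqrtr//.
rewrite mulrC -ler_pdivrMr ?divr_gt0// invf_div mulrC.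
exact: qm.
Qed.

Lemma tangent_norm_change c c' m v : A c -> A c' -> cdom c m -> cdom c' m ->
  tangent_norm g c' m (tangent_map id c c' m v) = tangent_norm g c m v.
Proof. by move=> Ac Ac' cm c'm; rewrite /tangent_norm gram_change. Qed.

Hypotheses (atlas : C1_atlas A) (M_compact : compact [set: M]).

(** Locally, a fixed chart compares the coordinates of [v] with its Riemannian
    norm; this norm does not depend on the chart and [M] is compact, so that
    finitely many local comparisons give a global one, in all charts. *)
Lemma C1_function_bound k (f : M -> 'rV[R]_k) : C1_function A f ->
  exists2 C, 0 <= C & forall c m v, A c -> cdom c m ->
    `|'d (f \o cinv c) (cmap c m) v| <= C * tangent_norm g c m v.
Proof.
move=> fC1; pose P (C : R) m := forall c v, A c -> cdom c m ->
  `|'d (f \o cinv c) (cmap c m) v| <= C * tangent_norm g c m v.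
have /compact_near_coveringP/(_ R +oo P _) cov := M_compact.
have : \forall C \near +oo, [set: M] `<=` P C.
  apply: cov => m0 _; have [c0 Ac0 c0m0] := atlas.1 m0.
  have [C1 C10 low] := tangent_norm_lower Ac0 c0m0.
  have [df cdf] := fC1 c0 Ac0.
  have c0u := cmap_img c0m0.
  have [C2 C20 fC2] := diff_bound (diff_continuous (df _ c0u)).
  have := diff_op_continuous (finite_basis_rV R n) (fun v => cdf v _ c0u) ltr01.
  move=> /(cmap_cvg c0m0) fop.
  have c0near : \forall m \near m0, cdom c0 m.
    by apply: open_nbhs_nbhs; split => //; exact: cdom_open.
  near=> m C.
  have leC : (C2 + 1) * C1 <= C.
    by near: C; apply: nbhs_pinfty_ge; exact: num_real.
  move=> c v Ac cm.
  have c0m : cdom c0 m by near: m.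
  have lowm : forall v, `|v| <= C1 * tangent_norm g c0 m v by near: m.
  have fopm : forall v, `|'d (f \o cinv c0) (cmap c0 m) v -
      'd (f \o cinv c0) (cmap c0 m0) v| <= 1 * `|v| by near: m.
  have [_ dE] := is_diff_in_charts (f := f) (psi := id) (c := c) (c' := c0) (m := m)
    (fun x => cvg_id) cm c0m ((atlas.2 c c0 Ac Ac0).1 _ (in_charts_domP (psi := id) cm c0m))
    (df _ (cmap_img c0m)).
  have -> : 'd (f \o cinv c) (cmap c m) v =
    'd (f \o cinv c0) (cmap c0 m) (tangent_map id c c0 m v).
    exact: (congr1 (fun k => k v) dE).
  rewrite -(tangent_norm_change v Ac Ac0 cm c0m).
  set w := tangent_map _ _ _ _ _.
  apply: (@le_trans _ _ ((C2 + 1) * `|w|)).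
    rewrite -(subrK ('d (f \o cinv c0) (cmap c0 m0) w) ('d _ _ w)).
    by rewrite (le_trans (ler_normD _ _))// addrC mulrDl lerD.
  apply: (@le_trans _ _ ((C2 + 1) * (C1 * tangent_norm g c0 m w))).
    by rewrite ler_wpM2l// addr_ge0.
  by rewrite mulrA ler_wpM2r ?tangent_norm_ge0.
move=> /pinfty_ex_gt0[C C0 PC]; exists C; first exact: ltW.
by move=> c m v Ac cm; exact: PC.
Unshelve. all: by end_near. Qed.

End Riemannian.

(** * Differentials along a compact set *)

Section DiffCompact.
Variables (R : realType) (U W : normedModType R) (f : U -> W) (K : set U).
Hypothesis K_compact : compact K.
Hypothesis df : forall x, differentiable f x.
Hypothesis dfc : forall x e, 0 < e ->
  \forall y \near x, forall v, `|'d f y v - 'd f x v| <= e * `|v|.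

Lemma diff_compact_bound :
  exists2 C, 0 <= C & forall p v, K p -> `|'d f p v| <= C * `|v|.
Proof.
pose P (C : R) p := forall v, `|'d f p v| <= C * `|v|.
have /compact_near_coveringP/(_ R +oo P _) cov := K_compact.
have : \forall C \near +oo, K `<=` P C.
  apply: cov => x _; have [C C0 fC] := diff_bound (diff_continuous (df x)).
  have dfx := dfc x ltr01.
  near=> y D.
  have CD : C + 1 <= D by near: D; apply: nbhs_pinfty_ge; exact: num_real.
  have dfy : forall v, `|'d f y v - 'd f x v| <= 1 * `|v| by near: y.
  move=> v; apply: (@le_trans _ _ ((C + 1) * `|v|)); last by rewrite ler_wpM2r.
  rewrite -(subrK ('d f x v) ('d f y v)) (le_trans (ler_normD _ _))//.
  by rewrite addrC mulrDl lerD.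
move=> /pinfty_ex_gt0[C C0 PC]; exists C; first exact: ltW.
by move=> p v /PC; exact.
Unshelve. all: by end_near. Qed.

(** The Heine-Cantor argument, for the operator norm of the differential. *)
Lemma diff_compact_uniform e : 0 < e -> exists2 del, 0 < del &
  forall p q, K p -> `|q - p| < del ->
    forall v, `|'d f q v - 'd f p v| <= e * `|v|.
Proof.
move=> e0; have e2 : 0 < e / 2 by rewrite divr_gt0.
pose P (del : R) p := forall q, `|q - p| < del ->
  forall v, `|'d f q v - 'd f p v| <= e * `|v|.
have /compact_near_coveringP/(_ R 0^'+ P _) cov := K_compact.
have KP : \forall del \near 0^'+, K `<=` P del.
  apply: cov => x _; have /nbhs_ballP[r /= r0 xr] := dfc x e2.
  have r2 : 0 < r / 2 by rewrite divr_gt0.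
  near=> y del.
  have xy : ball x (r / 2) y by near: y; exact: nbhsx_ballx.
  have delr : del < r / 2 by near: del; exact: nbhs_right_lt.
  move: xy; rewrite -ball_normE/= => xy q qy v.
  have xq : `|x - q| < r.
    rewrite -(subrKA y) (le_lt_trans (ler_normD _ _))// [r]splitr.
    by rewrite ltrD// distrC (lt_trans qy).
  have xyr : `|x - y| < r by rewrite (lt_le_trans xy)// ler_pdivrMr// ler_pMr// ler1n.
  have ex z : `|x - z| < r -> forall v, `|'d f z v - 'd f x v| <= e / 2 * `|v|.
    by move=> xz; apply: xr; rewrite -ball_normE.
  rewrite -(subrKA ('d f x v)) (le_trans (ler_normD _ _))//.
  rewrite [e]splitr mulrDl lerD ?ex//.
  by rewrite distrC ex.
have [del [del0 KPd]] : exists del : R, 0 < del /\ K `<=` P del.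
  apply: (@filter_ex _ (0 : R)^'+); near=> del; split; last by near: del.
  by near: del; exact: nbhs_right_gt.
by exists del => // p q /KPd; exact.
Unshelve. all: by end_near. Qed.

End DiffCompact.

(** * The contraction rates *)

Lemma sup_ge0_ge0 (R : realType) (X : set (\bar R)) : (0 <= sup_ge0 X)%E.
Proof. by rewrite /sup_ge0 le_max lexx. Qed.

Lemma sup_ge0_ubound (R : realType) (X : set (\bar R)) x : X x -> (x <= sup_ge0 X)%E.
Proof. by move=> Xx; rewrite /sup_ge0 le_max ereal_sup_ubound// orbT. Qed.

(** The strict inequality forces both suprema to be finite, so that it can be
    used through real constants [l] and [tau]. *)
Lemma contraction_rates (R : realType) (M : topologicalType) (n N d : nat)
    (A : set (chart R M n)) (g : riemannian_metric A) (psi : M -> M)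
    (F : 'rV[R]_N * 'rV[R]_d -> 'rV[R]_N) (V : set 'rV[R]_N) (Z : set 'rV[R]_d) :
  (forall p, differentiable F p) ->
  (sup_norm_DxF F V Z < mine 1 (1 / tangent_map_supnorm g psi))%E ->
  exists l tau : R, [/\ 0 <= l, 0 <= tau, l * tau < 1,
    forall x z y, V x -> Z z -> enorm ('d F (x, z) (y, 0)) <= l * enorm y
  & forall c c' m v, A c -> A c' -> cdom c m -> cdom c' (psi m) ->
      tangent_norm g c' (psi m) (tangent_map psi c c' m v) <= tau * tangent_norm g c m v].
Proof.
move=> dF; rewrite lt_min => /andP[].
have L0 : (0 <= sup_norm_DxF F V Z)%E by exact: sup_ge0_ge0.
have T0 : (0 <= tangent_map_supnorm g psi)%E by exact: sup_ge0_ge0.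
case LE : (sup_norm_DxF F V Z) => [l| |] // in L0 *; rewrite ?lee_fin in L0 *.
move=> _.
have DF x z y : V x -> Z z -> enorm ('d F (x, z) (y, 0)) <= l * enorm y.
  move=> Vx Zz; have [->|y0] := eqVneq y 0.
    have -> : 'd F (x, z) (0, 0) = 0 by exact: linear0.
    by rewrite !enorm0 mulr0.
  have ey : 0 < enorm y by rewrite (lt_le_trans _ (norm_le_enorm _))// normr_gt0.
  have dFxz : 'd F (x, z) (y, 0) = 'd (fun x => F (x, z)) x y.
    have dp : is_diff x (fun x : 'rV[R]_N => (x, z)) (fun y => (y, 0)).
      exact: is_diff_pair.
    have [_ dpE] := dp.
    have := diff_comp (@ex_diff _ _ _ _ _ _ _ dp) (dF (x, z)).
    move=> /(congr1 (fun k => k y)) /= ->.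
    by congr ('d F (x, z) _); rewrite -[RHS]/(('d _ _ : _ -> _) y) dpE.
  rewrite dFxz -ler_pdivrMr// -lee_fin -LE.
  apply: (@le_trans _ _ (opnorm ('d (fun x => F (x, z)) x))).
    by apply: sup_ge0_ubound; exists y.
  by apply: sup_ge0_ubound; exists (x, z).
have bound tau c c' m v : tangent_map_supnorm g psi = tau%:E -> A c -> A c' ->
    cdom c m -> cdom c' (psi m) ->
    tangent_norm g c' (psi m) (tangent_map psi c c' m v) <= tau * tangent_norm g c m v.
  move=> TE Ac Ac' cm c'm; have [->|v0] := eqVneq v 0.
    rewrite /tangent_map linear0 /tangent_norm !mul0mx !mxE sqrtr0.
    by rewrite mulr0.
  rewrite -ler_pdivrMr ?tangent_norm_gt0// -lee_fin -TE.
  apply: (@le_trans _ _ (tangent_map_norm g psi m)).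
    by apply: sup_ge0_ubound; exists c, c', v.
  by apply: sup_ge0_ubound; exists m.
case TE : (tangent_map_supnorm g psi) => [tau| |] // in T0 bound *.
  rewrite lee_fin in T0 => lT; exists l, tau; split => //; last first.
    by move=> c c' m v; apply: bound.
  move: lT; rewrite mul1e /inve; case: eqVneq => [->|t0]; first by rewrite mulr0.
  by rewrite lte_fin -[ltRHS]mul1r ltr_pdivlMr// lt0r t0.
(* An infinite supremum is excluded, since [1 / +oo = 0] is not above [l]. *)
by rewrite mul1e /inve lte_fin ltNge L0.
Qed.

(** * Differentiability of the generalized synchronization *)

Section SmoothSynchronization.
Variables (R : realType) (M : topologicalType) (n N d : nat).
Variables (A : set (chart R M n)) (g : riemannian_metric A).
Variables (phiV : M -> M) (omega : M -> 'rV[R]_d).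
Variables (F : 'rV[R]_N * 'rV[R]_d -> 'rV[R]_N) (V : set 'rV[R]_N).
Variables (v0 : 'rV[R]_N).

Local Notation f_ := (sync_iter phiV omega F v0).

Hypotheses (atlas : C1_atlas A) (phiV_C1 : C1_map A phiV).
Hypotheses (omega_C1 : C1_function A omega) (F_C2 : Ck 2 setT F).

Let fb := finite_basis_prod (finite_basis_rV R N) (finite_basis_rV R d).

Let dF p : differentiable F p. Proof. exact: F_C2.1. Qed.

Let F_C1 : Ck 1 setT F.
Proof.
split=> [p _|v p _]; first exact: dF.
exact/differentiable_continuous/(F_C2.2 v).1.
Qed.

Lemma sync_iter_C1 k : C1_function A (f_ k).
Proof.
elim: k => [|k IH] c Ac.
  split=> [u _|v u _]; first exact: (differentiable_cst v0).
  have -> : (fun u => 'd (f_ 0 \o cinv c) u v) = cst 0.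
    by apply/funext => u'; rewrite (diff_cst v0 u').
  exact: cst_continuous.
apply: Ck1_local => u cu.
have [c' Ac' c'm] := atlas.1 (phiV (cinv c u)).
have oE := in_charts_dom_open (c := c) (c' := c') phiV_C1.1.
exists (in_charts_dom phiV c c'), (F \o (fun u =>
  ((f_ k \o cinv c') (in_charts phiV c c' u), (omega \o cinv c) u))); split => //.
- apply: (Ck1_comp fb oE _ F_C1) => //; apply: (Ck1_pair oE).
    apply: (Ck1_comp (finite_basis_rV R n) oE (phiV_C1.2 c c' Ac Ac') (IH c' Ac')).
    by move=> u' [cu' c'u']; exact: cmap_img.
  by apply: Ck1_sub (omega_C1 Ac) => u' [].
- by move=> u' [cu' c'u']; rewrite /= /in_charts/= cmapK.
Qed.

(** The chain rule [T f_(k+1) = D F . (T f_k . T phiV, T omega)], in which the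
    chart [c'] around [phiV m] is arbitrary. *)
Lemma diff_sync_iterS k c c' m v : A c -> A c' -> cdom c m -> cdom c' (phiV m) ->
  'd (f_ k.+1 \o cinv c) (cmap c m) v =
  'd F (f_ k (phiV m), omega m)
    ('d (f_ k \o cinv c') (cmap c' (phiV m)) (tangent_map phiV c c' m v),
     'd (omega \o cinv c) (cmap c m) v).
Proof.
move=> Ac Ac' cm c'm.
have [d1 d1E] := is_diff_in_charts (f := f_ k) phiV_C1.1 cm c'm
  ((phiV_C1.2 c c' Ac Ac').1 _ (in_charts_domP cm c'm))
  ((sync_iter_C1 k Ac').1 _ (cmap_img c'm)).
have d2 := (omega_C1 Ac).1 _ (cmap_img cm).
pose pr u := ((f_ k \o phiV \o cinv c) u, (omega \o cinv c) u).
have dpr : differentiable pr (cmap c m) by exact: differentiable_pair.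
have prE : pr (cmap c m) = (f_ k (phiV m), omega m) by rewrite /pr/= cmapK.
have dprE : 'd pr (cmap c m) v =
    ('d (f_ k \o cinv c') (cmap c' (phiV m)) (tangent_map phiV c c' m v),
     'd (omega \o cinv c) (cmap c m) v).
  have d1v := congr1 (fun h => h v) d1E.
  exact: etrans (congr1 (fun h => h v) (diff_pair d1 d2)) (congr1 (pair^~ _) d1v).
transitivity ('d F (pr (cmap c m)) ('d pr (cmap c m) v)).
  exact: (congr1 (fun h => h v) (diff_comp dpr (dF _))).
exact: (congr2 (fun p y => 'd F p y) prE dprE).
Qed.

Variables (l tau : R).
Hypotheses (l0 : 0 <= l) (tau0 : 0 <= tau) (ltau : l * tau < 1).
Hypothesis DxF_le : forall x z y, V x -> range omega z ->
  enorm ('d F (x, z) (y, 0)) <= l * enorm y.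
Hypothesis TphiV_le : forall c c' m v, A c -> A c' -> cdom c m -> cdom c' (phiV m) ->
  tangent_norm g c' (phiV m) (tangent_map phiV c c' m v) <= tau * tangent_norm g c m v.
Hypothesis M_compact : compact [set: M].
Hypothesis omega_continuous : continuous omega.
Hypothesis sync_in : forall k m, V (f_ k m).
Hypothesis sync_bounded : exists r, forall k m, enorm (f_ k m - v0) <= r.
Hypothesis sync_cauchy : forall e, 0 < e -> exists n0, forall k k',
  (n0 <= k)%N -> (n0 <= k')%N -> forall m, enorm (f_ k' m - f_ k m) <= e.

Let rangeP m : range omega (omega m). Proof. by exists m. Qed.

(* The constant of [enorm_le_norm]. *)
Let kappa := Num.sqrt N%:R : R.
Let kappa0 : 0 <= kappa. Proof. exact: sqrtr_ge0. Qed.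

Let dFop x e : 0 < e ->
  \forall y \near x, forall v, `|'d F y v - 'd F x v| <= e * `|v|.
Proof. by apply: (diff_op_continuous fb) => v; exact: F_C1.2. Qed.

(** The points at which ['d F] occurs in the differentials of the iterates lie in
    a ball times the range of [omega]. *)
Lemma sync_orbit_compact : exists2 K : set ('rV[R]_N * 'rV[R]_d), compact K &
  forall k m m', K (f_ k m, omega m').
Proof.
have [r fr] := sync_bounded.
exists ([set x | `|x| <= r + `|v0|] `*` range omega); last first.
  move=> k m m'; split; last exact: rangeP.
  rewrite /= -(subrK v0 (f_ k m)) (le_trans (ler_normD _ _))// lerD2r.
  exact: le_trans (norm_le_enorm _) (fr k m).
apply: compact_setX; last first.
  by apply: continuous_compact => //; exact: continuous_subspaceT.
apply: bounded_closed_compact.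
  exists (r + `|v0|); split=> [|s rs x /= xr]; first exact: num_real.
  exact: le_trans xr (ltW rs).
rewrite (_ : mkset _ = (fun x : 'rV[R]_N => `|x|) @^-1` [set s | s <= r + `|v0|])//.
by apply: closed_comp => [x _|]; [exact: norm_continuous|exact: closed_le].
Qed.

(** Splitting ['d F (y, w)] into its state and observation parts, a bound [C] for
    one iterate gives the bound [l tau C + b] for the next, where [b] bounds the
    observation part. *)
Lemma diff_sync_iter_bounded : exists2 C, 0 <= C & forall k c m v, A c -> cdom c m ->
  enorm ('d (f_ k \o cinv c) (cmap c m) v) <= C * tangent_norm g c m v.
Proof.
have [K cK fK] := sync_orbit_compact.
have [CF CF0 dFK] := diff_compact_bound cK dF dFop.
have [Co Co0 domega] := C1_function_bound g atlas M_compact omega_C1.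
have ltau1 : 0 < 1 - l * tau by rewrite subr_gt0.
(* The solution of [C = l tau C + kappa CF Co]. *)
pose C := kappa * CF * Co / (1 - l * tau).
have C0 : 0 <= C by rewrite divr_ge0 ?mulr_ge0// ltW.
exists C => //; elim=> [|k IH] c m v Ac cm.
  have -> : 'd (f_ 0 \o cinv c) (cmap c m) v = 0 by rewrite (diff_cst v0).
  by rewrite enorm0 mulr_ge0// tangent_norm_ge0.
have [c' Ac' c'm] := atlas.1 (phiV m).
rewrite (diff_sync_iterS _ _ Ac Ac' cm c'm).
set y := 'd (f_ k \o cinv c') _ _; set w := 'd (omega \o _) _ _.
have -> : 'd F (f_ k (phiV m), omega m) (y, w) =
    'd F (f_ k (phiV m), omega m) (y, 0) + 'd F (f_ k (phiV m), omega m) (0, w).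
  by rewrite -linearD; congr ('d F _ (_, _)); rewrite ?addr0 ?add0r.
apply: le_trans (enormD _ _) _.
have -> : C * tangent_norm g c m v =
    l * (C * (tau * tangent_norm g c m v)) + kappa * (CF * (Co * tangent_norm g c m v)).
  by rewrite /C; field; rewrite gt_eqF.
apply: lerD.
  rewrite (le_trans (DxF_le _ _ _))// ler_wpM2l//.
  by rewrite (le_trans (IH _ _ _ _ _))// ler_wpM2l// TphiV_le.
rewrite (le_trans (enorm_le_norm _))// ler_wpM2l//.
rewrite (le_trans (dFK _ _ _))// ler_wpM2l// prod_normE/= normr0.
by rewrite ge_max domega// mulr_ge0// tangent_norm_ge0.
Qed.

(** The differentials are contracted at the rate [l tau], up to the variation
    of ['d F] between the base points of two iterates, which vanishes by the
    uniform continuity of ['d F]. *)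
Lemma diff_sync_iter_cauchy e : 0 < e -> exists n0, forall k k',
  (n0 <= k)%N -> (n0 <= k')%N -> forall c m v, A c -> cdom c m ->
  enorm ('d (f_ k' \o cinv c) (cmap c m) v - 'd (f_ k \o cinv c) (cmap c m) v)
    <= e * tangent_norm g c m v.
Proof.
have [K cK fK] := sync_orbit_compact.
have [Co Co0 domega] := C1_function_bound g atlas M_compact omega_C1.
have [C C0 dfC] := diff_sync_iter_bounded.
move: e; apply: (@contraction_all _ _ (l * tau) (C + C)).
- by rewrite mulr_ge0.
- move=> s t st [n0 Qs]; exists n0 => k k' nk nk' c m v Ac cm.
  by rewrite (le_trans (Qs _ _ nk nk' c m v Ac cm))// ler_wpM2r// tangent_norm_ge0.
- exists 0%N => k k' _ _ c m v Ac cm.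
  by rewrite (le_trans (enormD _ _))// enormN mulrDl lerD// dfC.
move=> s e s0 e0 [n1 Qs].
pose B := C * tau + Co.
have B0 : 0 <= B by rewrite addr_ge0// mulr_ge0.
have kB : 0 < kappa * B + 1 by rewrite ltr_wpDl// mulr_ge0.
pose e' := e / (kappa * B + 1).
have e'0 : 0 < e' by rewrite divr_gt0.
have [del del0 dFdel] := diff_compact_uniform cK dFop e'0.
have [n2 fn2] := sync_cauchy (divr_gt0 del0 (ltr0Sn _ 1)).
(* The state part of the first differential is contracted, and the variation of
   ['d F] acts on a vector of norm at most [B t]. *)
have step x' x z y' y w t : V x' -> range omega z -> K (x, z) -> 0 <= t ->
    `|x' - x| < del -> enorm (y' - y) <= s * (tau * t) ->
    enorm y <= C * (tau * t) -> `|w| <= Co * t ->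
    enorm ('d F (x', z) (y', w) - 'd F (x, z) (y, w)) <= (l * tau * s + e) * t.
  move=> Vx' zr Kx t0 x'x y'y yt wt.
  have -> : 'd F (x', z) (y', w) - 'd F (x, z) (y, w) =
      'd F (x', z) (y' - y, 0) + ('d F (x', z) (y, w) - 'd F (x, z) (y, w)).
    by rewrite addrA -linearD; congr ('d F _ (_, _) - _); rewrite ?subrK ?add0r.
  apply: le_trans (enormD _ _) _; rewrite [leRHS]mulrDl; apply: lerD.
    apply: le_trans (DxF_le _ Vx' zr) _; rewrite -!mulrA ler_wpM2l//.
    by rewrite [tau * _]mulrCA.
  have pp' : `|(x', z) - (x, z)| < del.
    by rewrite prod_normE/= subrr normr0 gt_max del0 andbT.
  have yw : `|(y, w)| <= B * t.
    rewrite prod_normE/= ge_max mulrDl; apply/andP; split.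
      rewrite ler_wpDr ?mulr_ge0// -mulrA.
      exact: le_trans (norm_le_enorm _) yt.
    by rewrite ler_wpDl ?mulr_ge0.
  apply: le_trans (enorm_le_norm _) _.
  apply: (@le_trans _ _ (kappa * (e' * (B * t)))).
    rewrite ler_wpM2l//; apply: le_trans (dFdel _ _ Kx pp' _) _.
    by rewrite ler_wpM2l// ltW.
  have -> : kappa * (e' * (B * t)) = e' * (kappa * B) * t by ring.
  rewrite ler_wpM2r// /e' mulrAC ler_pdivrMr//; apply: ler_wpM2l; first exact: ltW.
  by rewrite lerDl.
exists (maxn n1 n2).+1 => -[//|k] [//|k'] nk nk' c m v Ac cm.
move: nk nk'; rewrite !ltnS !geq_max => /andP[n1k n2k] /andP[n1k' n2k'].
have [c' Ac' c'm] := atlas.1 (phiV m).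
have Tv := TphiV_le v Ac Ac' cm c'm.
rewrite [X in X - _](diff_sync_iterS k' v Ac Ac' cm c'm).
rewrite [X in _ - X](diff_sync_iterS k v Ac Ac' cm c'm).
apply: step => //.
- exact: tangent_norm_ge0.
- apply: le_lt_trans (norm_le_enorm _) _; apply: le_lt_trans (fn2 _ _ n2k n2k' _) _.
  by rewrite ltr_pdivrMr// ltr_pMr// ltr1n.
- apply: le_trans (Qs _ _ n1k n1k' c' _ _ Ac' c'm) _.
  by apply: ler_wpM2l => //; exact: ltW.
- apply: le_trans (dfC _ _ _ _ Ac' c'm) _.
  exact: ler_wpM2l.
- exact: domega.
Qed.

(** On a neighborhood of a point, the Riemannian norm is at most [C] times the
    coordinate norm, so the estimates of the differentials hold in the chart. *)
Lemma sync_limit_C1 f : (forall m, f_ k m @[k --> \oo] --> f m) -> C1_function A f.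
Proof.
move=> flim c Ac; apply: (@C1_limit _ _ _ _ (fun k => f_ k \o cinv c)).
- exact: cimg_open.
- by move=> k; exact: sync_iter_C1.
- by move=> u cu; exact: flim.
move=> u0 cu0; have cm0 := cinv_dom cu0.
have [C C0 tC] := tangent_norm_upper g Ac cm0.
exists [set u | cimg c u /\ forall v, tangent_norm g c (cinv c u) v <= C * `|v|].
  apply: filterI; last exact: (cinv_cvg cu0 tC).
  by apply: open_nbhs_nbhs; split => //; exact: cimg_open.
move=> e e0; have C1_gt0 : 0 < C + 1 by rewrite ltr_wpDl.
have [K fK] := diff_sync_iter_cauchy (divr_gt0 e0 C1_gt0).
exists K => k k' Kk Kk' u [cu tu] v.
have := fK _ _ Kk Kk' c (cinv c u) v Ac (cinv_dom cu); rewrite cinvK// => fKu.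
rewrite (le_trans (norm_le_enorm _))// (le_trans fKu)//.
apply: (@le_trans _ _ (e / (C + 1) * (C * `|v|))).
  by rewrite ler_wpM2l// divr_ge0// ltW.
rewrite mulrA ler_wpM2r// mulrAC ler_pdivrMr// ler_wpM2l ?ltW//.
by rewrite ltrDl.
Qed.

End SmoothSynchronization.

Theorem mainTheorem1 (R : realType) (M : topologicalType) (N d : nat)
    (phi phiV : M -> M) (omega : M -> 'rV[R]_d)
    (F : 'rV[R]_N * 'rV[R]_d -> 'rV[R]_N) (V : set 'rV[R]_N)
    (M_compact : compact [set: M])
    (phiK : cancel phi phiV) (phiVK : cancel phiV phi)
    (phi_continuous : continuous phi) (phiV_continuous : continuous phiV)
    (omega_continuous : continuous omega)
    (F_continuous : continuous F)
    (F_locally_contracting : locally_contracting omega F)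
    (V_nonempty : V !=set0) (V_closed : closed V)
    (V_invariant : state_invariant F V (range omega))
    (V_contracting : state_contracting F V (range omega)) :
  ((bounded_set V -> synchronizes phi phiV omega F (maps_into V)) /\
   synchronizes phi phiV omega F (bounded_maps_into V)) /\
  (forall (n : nat) (A : set (chart R M n)) (g : riemannian_metric A),
     C1_atlas A -> connected [set: M] -> hausdorff_space M ->
     @second_countable M ->
     C1_map A phi -> C1_map A phiV -> C1_function A omega ->
     Ck 2 setT F -> convex_set V ->
     ((bounded_set V -> synchronizes phi phiV omega F (maps_into V)) /\
      synchronizes phi phiV omega F (bounded_maps_into V)) /\
     ((sup_norm_DxF F V (range omega) <
         mine 1 (1 / tangent_map_supnorm g phiV))%E ->
      (bounded_set V ->
         C1_function A
           (generalized_synchronization phi phiV omega F (maps_into V))) /\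
      C1_function A
        (generalized_synchronization phi phiV omega F (bounded_maps_into V)))).
Proof.
have [v0 Vv0] := V_nonempty.
have [c c01 Fc] := V_contracting.
have [f [cf bf f_fix flim]] := sync_limit V_invariant c01 Fc M_compact
  phiV_continuous omega_continuous F_continuous Vv0 V_closed.
have [gsE sync] := synchronizesP phiK c01 Fc cf bf f_fix.
have bddE : bounded_set V -> maps_into V = bounded_maps_into V.
  move=> /pinfty_ex_gt0[K _ VK]; apply: functional_extensionality_dep => T; apply/seteqP.
  split=> [h Vh|h []//]; split=> //; apply/bounded_fun_rVP; exists K => t.
  exact/VK/Vh.
have syncs : (bounded_set V -> synchronizes phi phiV omega F (maps_into V)) /\
    synchronizes phi phiV omega F (bounded_maps_into V).
  by split=> // /bddE ->.
split=> // n A g atlas _ _ _ _ phiV_C1 omega_C1 F_C2 _; split=> // rate.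
have fC1 : C1_function A f; last first.
  split=> [/bddE VE|]; last by rewrite gsE.
  by rewrite VE gsE.
have dF p : differentiable F p by exact: F_C2.1.
have [l [tau [l0 tau0 ltau DxF_le TphiV_le]]] := contraction_rates dF rate.
apply: (sync_limit_C1 atlas phiV_C1 omega_C1 F_C2 l0 tau0 ltau DxF_le TphiV_le
  M_compact omega_continuous (v0 := v0)).
- by move=> k m; exact: sync_iter_in.
- exact: sync_iter_bounded Fc M_compact omega_continuous F_continuous Vv0.
- exact: sync_iter_cauchy Fc M_compact omega_continuous F_continuous Vv0.
by move=> m; apply/cvgrPdist_le => e /flim[k0 fk]; exists k0 => // k /= ?; exact: fk.
Qed.
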